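(* There exists a metric space $X$ with the following properties. (i) $X$ is proper, geodesic, and contractible. (ii) $\mathrm{Isom}(X)\simeq\mathbf{Z}$, and in particular $\mathrm{Isom}(X)$ has trivial point stabilizers. (iii) $\mathrm{Isom}(X)$ is cocompact; more precisely, there exists $x\in X$ such that $\mathrm{Isom}(X)\cdot B(x,1)=X$. (iv) For every $R>0$, there exists a continuum of pairwise non-isometric metric spaces which are $R$-locally $X$ and which satisfy (i), (ii) and (iii). (v) For every $R>0$, there exists a continuum of pairwise non-isometric metric spaces which are $R$-locally $X$ and have a trivial isometry group. (vi) For every $R>0$, there exists a continuum of pairwise non-isometric metric spaces which are $R$-locally $X$ and have an uncountable cocompact isometry group, and there also exists a continuum of pairwise non-isometric metric spaces which are $R$-locally $X$ and have an uncountable non-cocompact isometry group.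
   Context: Balls $B(x,R)$ are closed balls. A metric space is proper if its closed balls are compact. $\mathrm{Isom}(X)$ is the group of (bijective) isometries of $X$; it is cocompact if there is a compact set whose translates under it cover $X$. A metric space $Y$ is $R$-locally $X$ if for every $y\in Y$ there exists $x\in X$ such that the balls $B_X(x,R)$ and $B_Y(y,R)$, equipped with their intrinsic geodesic metrics, are isometric. ''A continuum of'' means a family with the cardinality of the continuum. *)

(* Defs.v *)
From HB Require Import structures.
From mathcomp Require Import all_boot all_order all_algebra.
From mathcomp Require Import all_classical all_reals all_analysis.

Set Implicit Arguments.
Unset Strict Implicit.
Unset Printing Implicit Defensive.

Import Order.TTheory GRing.Theory Num.Theory.
Import numFieldNormedType.Exports.

Local Open Scope classical_set_scope.
Local Open Scope ring_scope.

(* Not the library's closed_ball, which is the closure of the open ball and may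
   be strictly smaller in a general metric space. *)
Definition cball (R : realType) (X : metricType R) (x : X) (r : R) : set X :=
  [set y | mdist x y <= r].

Definition proper_space (R : realType) (X : metricType R) : Prop :=
  forall (x : X) (r : R), compact (cball x r).

Definition geodesic_space (R : realType) (X : metricType R) : Prop :=
  forall x y : X, exists c : R -> X,
    [/\ c 0 = x, c (mdist x y) = y &
        {in `[0, mdist x y] &, forall s t, mdist (c s) (c t) = `|s - t|}].

(* The identity is homotopic to a constant map; in particular X is nonempty. *)
Definition contractible (R : realType) (X : metricType R) : Prop :=
  exists (x0 : X) (h : X * R -> X),
    [/\ {within [set: X] `*` `[0, 1], continuous h},
        forall x, h (x, 0) = x &
        forall x, h (x, 1) = x0].

Definition isometric (R : realType) (X Y : metricType R) : Prop :=
  exists2 f : X -> Y, bijective f &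
    forall x y, mdist (f x) (f y) = mdist x y.

Record isom (R : realType) (X : metricType R) := Isom {
  isom_fun :> X -> X;
  isom_mdist : forall x y, mdist (isom_fun x) (isom_fun y) = mdist x y;
  isom_bij : bijective isom_fun }.

Section isom_group.
Context (R : realType) (X : metricType R).
Implicit Types g h : isom X.

HB.instance Definition _ := gen_eqMixin (isom X).
HB.instance Definition _ := gen_choiceMixin (isom X).

Lemma isom_eq g h : g =1 h -> g = h.
Proof.
case: g => f f1 f2; case: h => k k1 k2 /= /funext fk.
by case: _ / fk in k1 k2 *; congr Isom; exact: Prop_irrelevance.
Qed.

Definition isom_one : isom X :=
  Isom (fun x y : X => erefl (mdist x y)) (Bijective (fun=> erefl) (fun=> erefl)).

Lemma isom_comp_mdist g h x y : mdist ((g \o h) x) ((g \o h) y) = mdist x y.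
Proof. by rewrite /= !isom_mdist. Qed.

Definition isom_mul g h : isom X :=
  Isom (isom_comp_mdist g h) (bij_comp (isom_bij g) (isom_bij h)).

Lemma isom_inv_subproof g : exists h, cancel g h /\ cancel h g.
Proof.
case: (isom_bij g) => k gk kg.
have kd x y : mdist (k x) (k y) = mdist x y by rewrite -(isom_mdist g) !kg.
by exists (Isom kd (Bijective kg gk)).
Qed.

Definition isom_inv g : isom X := projT1 (cid (isom_inv_subproof g)).

Lemma isom_mulA : associative isom_mul.
Proof. by move=> f g h; apply: isom_eq. Qed.

Lemma isom_mul1g : left_id isom_one isom_mul.
Proof. by move=> g; apply: isom_eq. Qed.

Lemma isom_mulg1 : right_id isom_one isom_mul.
Proof. by move=> g; apply: isom_eq. Qed.

Lemma isom_mulVg : left_inverse isom_one isom_inv isom_mul.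
Proof.
move=> g; apply: isom_eq => x /=.
by rewrite /isom_inv; case: cid => h [/= gh _]; exact: gh.
Qed.

Lemma isom_mulgV : right_inverse isom_one isom_inv isom_mul.
Proof.
move=> g; apply: isom_eq => x /=.
by rewrite /isom_inv; case: cid => h [/= _ hg]; exact: hg.
Qed.

HB.instance Definition _ := isGroup.Build (isom X)
  isom_mulA isom_mul1g isom_mulg1 isom_mulVg isom_mulgV.

End isom_group.

Definition isom_group_is_Z (R : realType) (X : metricType R) : Prop :=
  exists2 phi : isom X -> int, bijective phi &
    forall g h, phi (g * h)%g = phi g + phi h.

Definition trivial_stabilizers (R : realType) (X : metricType R) : Prop :=
  forall (x : X) (g : isom X), g x = x -> g = 1%g.

Definition trivial_isom_group (R : realType) (X : metricType R) : Prop :=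
  forall g : isom X, g = 1%g.

Definition uncountable_isom_group (R : realType) (X : metricType R) : Prop :=
  ~ countable [set: isom X].

Definition isom_translates (R : realType) (X : metricType R) (K : set X)
    : set X :=
  \bigcup_(g in [set: isom X]) (g @` K).

Definition cocompact_isom_group (R : realType) (X : metricType R) : Prop :=
  exists2 K : set X, compact K & isom_translates K = [set: X].

(* Length of a path parametrized by [0, 1]: the metric analogue of the
   library's total_variation. *)
Definition polygonal_length (R : realType) (X : metricType R) (c : R -> X)
    (s : seq R) : R :=
  let F := c \o nth 1 (0 :: s) in
  \sum_(0 <= n < size s) mdist (F n) (F n.+1).

Definition path_length (R : realType) (X : metricType R) (c : R -> X)
    : \bar R :=
  ereal_sup [set (polygonal_length c s)%:E | s in itv_partition 0 1].

(* Extended-valued: +oo when S contains no rectifiable path from x to y. *)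
Definition intrinsic_dist (R : realType) (X : metricType R) (S : set X)
    (x y : X) : \bar R :=
  ereal_inf [set path_length c | c in
    [set c : R -> X | [/\ {within `[0, 1], continuous c},
                          c 0 = x, c 1 = y & c @` `[0, 1] `<=` S]]].

Definition intrinsically_isometric (R : realType) (X Y : metricType R)
    (A : set X) (B : set Y) : Prop :=
  exists2 f : X -> Y, set_bij A B f &
    forall a b, A a -> A b ->
      intrinsic_dist B (f a) (f b) = intrinsic_dist A a b.

Definition locally_modelled (R : realType) (r : R) (X Y : metricType R)
    : Prop :=
  forall y : Y, exists x : X,
    intrinsically_isometric (cball x r) (cball y r).

(* The index set R has exactly the cardinality of the continuum. *)
Definition continuum_of_nonisometric (R : realType)
    (P : metricType R -> Prop) : Prop :=
  exists Y : R -> metricType R,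
    (forall t, P (Y t)) /\ (forall s t, s != t -> ~ isometric (Y s) (Y t)).

Definition proper_geodesic_contractible (R : realType) (X : metricType R)
    : Prop :=
  [/\ proper_space X, geodesic_space X & contractible X].

Definition isom_Z_free (R : realType) (X : metricType R) : Prop :=
  isom_group_is_Z X /\ trivial_stabilizers X.

Definition isom_cocompact_unit_ball (R : realType) (X : metricType R) : Prop :=
  cocompact_isom_group X /\
  exists x : X, isom_translates (cball x 1) = [set: X].

(* Main.v *)
(* Glue half-strips ("pages") {(t, u) : 0 <= u <= phi_j(t)} along a
   common spine u = 0; the distance of two points is the maximum of the
   difference of their t-coordinates and of their distance in the star of pages.
   The heights phi_j are positive and 1-Lipschitz and tend to 0 with j, which
   makes the book proper; clipping heights is a 1-Lipschitz retraction of the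
   product of the line with a star, hence the book is geodesic and contractible.
   Far apart points only see the t-coordinate, the spine consists of the branch
   points, and pages are told apart locally; so an isometry is exactly a
   t -> +-t + c together with a permutation of pages matching the heights.

   Pages come in classes: class k has pages (k, 0), ..., (k, k), of heights
   between 4^-(k+1) and 2 * 4^-(k+1), so that isometries preserve classes. Every
   integer n puts a bump on one page x_k(n) of class k. Class 0 is bumped at
   n + 1/3 instead of n, which leaves only the isometries t -> t + n.
   In X, x_k(n) = n mod k+1. Seen through a ball of radius r, the bumps of a class
   k >> r all lie on distinct pages, so any labelling x_k which is injective on
   long windows gives the same balls: one may replace k+1 by smaller periods
   (which leaves blank pages, and two blank pages of a class can be swapped)
   and destroy the translations by a defect at n = 0. *)

Require Import Defs.
From HB Require Import structures.
From mathcomp Require Import all_boot all_order all_algebra.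
From mathcomp Require Import all_classical all_reals all_analysis.
From mathcomp Require Import ring lra zify.

Set Implicit Arguments.
Unset Strict Implicit.
Unset Printing Implicit Defensive.

Import Order.TTheory GRing.Theory Num.Theory.
Import numFieldNormedType.Exports.
Import metricType_numDomainType.

Local Open Scope classical_set_scope.
Local Open Scope ring_scope.

(** * The book of a profile *)

Ltac abs_lra := rewrite ler_norml; apply/andP; split; lra.

(** The bound [2^-1] hides heights from distances above 1; the Lipschitz condition makes clipping
    nonexpansive; the dichotomy keeps each nonempty page connected off the spine; finiteness gives
    properness; three pages make every spine point branch. A zero sheet encodes an absent page. *)
Record profile (R : realType) := Profile {
  sheet :> nat * nat -> R -> R;
  sheet_ge0 : forall j t, 0 <= sheet j t;
  sheet_le_half : forall j t, sheet j t <= 2^-1;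
  sheet_lip : forall j t s, `|sheet j t - sheet j s| <= `|t - s|;
  sheet_dichotomy : forall j,
    (exists2 b, 0 < b & forall t, b <= sheet j t) \/ (forall t, sheet j t = 0);
  sheet_finite : forall e, 0 < e ->
    exists s : seq (nat * nat), forall j t, j \notin s -> sheet j t <= e;
  sheet_three : exists j1 j2 j3, [/\ j1 != j2, j2 != j3, j1 != j3 &
    forall t, [/\ 0 < sheet j1 t, 0 < sheet j2 t & 0 < sheet j3 t]] }.

Section book.
Context {R : realType}.
Implicit Types (j l : nat * nat) (t s u v : R).

Definition star_dist j u l v : R := if j == l then `|u - v| else u + v.

Lemma star_distC j u l v : star_dist j u l v = star_dist l v j u.
Proof. by rewrite /star_dist eq_sym distrC [u + v]addrC. Qed.

Lemma star_dist_le j u l v : 0 <= u -> 0 <= v -> star_dist j u l v <= u + v.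
Proof.
by move=> u0 v0; rewrite /star_dist; case: ifP => // _; abs_lra.
Qed.

Lemma star_dist_ge j u l v : 0 <= u -> 0 <= v -> `|u - v| <= star_dist j u l v.
Proof.
by move=> u0 v0; rewrite /star_dist; case: ifP => // _; abs_lra.
Qed.

Lemma star_dist_triangle j u l v k w : 0 <= u -> 0 <= v -> 0 <= w ->
  star_dist j u k w <= star_dist j u l v + star_dist l v k w.
Proof.
move=> u0 v0 w0; rewrite /star_dist.
have [->|jl] := eqVneq j l; have [lk|lk] := eqVneq l k;
  rewrite ?(negbTE jl) -?lk ?eqxx ?(negbTE lk) ?(negbTE jl).
- exact: ler_distD.
- have := ler_norm (u - v); lra.
- have := ler_norm (w - v); rewrite distrC; lra.
- case: ifP => _; last lra.
  by abs_lra.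
Qed.

Lemma star_dist0 j l v : 0 <= v -> star_dist j 0 l v = v.
Proof.
by move=> v0; rewrite /star_dist; case: ifP; rewrite ?sub0r ?normrN ?ger0_norm ?add0r.
Qed.

(** A spine point belongs to all pages; the conventional page [(0, 0)] gives it a single
    representative, so that points at distance 0 are equal. *)
Definition in_book (phi : profile R) (x : R * (nat * nat) * R) :=
  (0 <= x.2 <= phi x.1.2 x.1.1) && ((x.2 == 0) ==> (x.1.2 == (0, 0)%N)).

Record book (phi : profile R) := Book {
  book_val : R * (nat * nat) * R;
  book_valP : in_book phi book_val }.

HB.instance Definition _ phi := [isSub for @book_val phi].
HB.instance Definition _ phi := [Choice of book phi by <:].

(** * The metric of a book and its clipped points *)

Section metric.
Variable phi : profile R.
Implicit Types x y z : book phi.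

Definition pos x : R := (book_val x).1.1.
Definition page x : nat * nat := (book_val x).1.2.
Definition height x : R := (book_val x).2.

Lemma height_ge0 x : 0 <= height x.
Proof. by case/andP: (book_valP x) => /andP[]. Qed.
Hint Resolve height_ge0 : core.

Lemma height_le x : height x <= phi (page x) (pos x).
Proof. by case/andP: (book_valP x) => /andP[]. Qed.

Lemma height0_page x : height x = 0 -> page x = (0, 0)%N.
Proof.
by move=> h0; case/andP: (book_valP x) => _ /implyP/(_ (introT eqP h0))/eqP.
Qed.

Lemma book_ext x y : pos x = pos y -> page x = page y -> height x = height y ->
  x = y.
Proof.
move=> p q r; apply: val_inj; move: p q r; rewrite /pos /page /height /=.
by case: (book_val x) => [[? ?] ?]; case: (book_val y) => [[? ?] ?] /= -> -> ->.
Qed.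

Definition page_dist x y := star_dist (page x) (height x) (page y) (height y).

Definition book_dist x y : R := Num.max `|pos x - pos y| (page_dist x y).

Let book_distxx x : book_dist x x = 0.
Proof. by rewrite /book_dist /page_dist /star_dist eqxx !subrr normr0 maxxx. Qed.

Let book_dist_sym x y : book_dist x y = book_dist y x.
Proof. by rewrite /book_dist /page_dist star_distC distrC. Qed.

Let book_dist_pos x y : book_dist x y = 0 -> x = y.
Proof.
move=> d0; have : book_dist x y <= 0 by rewrite d0.
rewrite ge_max normr_le0 subr_eq0 => /andP[/eqP txy].
rewrite /page_dist /star_dist; case: eqP => [pxy|pxy].
  by rewrite normr_le0 subr_eq0 => /eqP; apply: book_ext.
have := height_ge0 x; have := height_ge0 y => hy hx hxy; exfalso; apply: pxy.
by rewrite !height0_page //; lra.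
Qed.

Let book_dist_triangle y x z : book_dist x z <= book_dist x y + book_dist y z.
Proof.
rewrite {1}/book_dist ge_max; apply/andP; split.
  by rewrite (le_trans (ler_distD (pos y) _ _))// lerD// le_max lexx.
rewrite (le_trans (star_dist_triangle (page x) (page y) (page z)
  (height_ge0 x) (height_ge0 y) (height_ge0 z)))//.
by rewrite lerD// le_max lexx orbT.
Qed.

HB.instance Definition _ := isMetric.Build R (book phi)
  book_distxx book_dist_pos book_dist_sym book_dist_triangle.

Lemma mdistE x y : mdist x y = Num.max `|pos x - pos y| (page_dist x y).
Proof. by []. Qed.

Lemma mdist_leP x y e :
  mdist x y <= e <-> `|pos x - pos y| <= e /\ page_dist x y <= e.
Proof. by rewrite mdistE ge_max; split=> [/andP|] //; move/andP. Qed.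

Lemma mdist_ltP x y e :
  mdist x y < e <-> `|pos x - pos y| < e /\ page_dist x y < e.
Proof. by rewrite mdistE gt_max; split=> [/andP|] //; move/andP. Qed.

Lemma pos_mdist x y : `|pos x - pos y| <= mdist x y.
Proof. by rewrite mdistE le_max lexx. Qed.

Lemma page_dist_mdist x y : page_dist x y <= mdist x y.
Proof. by rewrite mdistE le_max lexx orbT. Qed.

Lemma mdist_fiber x y : pos x = pos y -> mdist x y = page_dist x y.
Proof.
move=> xy; rewrite mdistE xy subrr normr0; apply/max_idPr.
by rewrite (le_trans _ (star_dist_ge _ _ _ _)).
Qed.

(** Clipping makes [book_point] total, so paths and homotopies can be written down before knowing
    that they stay below the page height. *)
Definition clip t j u : R := Num.max 0 (Num.min u (phi j t)).

Definition clip_val t j u : R * (nat * nat) * R :=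
  (t, if clip t j u == 0 then (0, 0)%N else j, clip t j u).

Lemma clip_valP t j u : in_book phi (clip_val t j u).
Proof.
rewrite /in_book /= /clip le_max lexx /=; case: eqP => [->|_ /=].
  by rewrite sheet_ge0.
by rewrite andbT ge_max sheet_ge0 ge_min lexx orbT.
Qed.

Definition book_point t j u : book phi := Book (clip_valP t j u).

Lemma pos_point t j u : pos (book_point t j u) = t. Proof. by []. Qed.

Lemma clip_id t j u : 0 <= u <= phi j t -> clip t j u = u.
Proof.
by move=> /andP[u0 uphi]; rewrite /clip; move/min_idPl: uphi => ->; apply/max_idPr.
Qed.

Lemma height_point t j u : 0 <= u <= phi j t -> height (book_point t j u) = u.
Proof. exact: clip_id. Qed.

Lemma page_point t j u : 0 < u <= phi j t -> page (book_point t j u) = j.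
Proof.
move=> /andP[u0 uphi]; rewrite /page /= clip_id ?(ltW u0)//.
by rewrite gt_eqF.
Qed.

Lemma book_pointK x : book_point (pos x) (page x) (height x) = x.
Proof.
have xh : 0 <= height x <= phi (page x) (pos x) by rewrite height_ge0 height_le.
apply: book_ext => //; last by rewrite height_point.
rewrite {1}/page /= clip_id//; case: eqP => // /height0_page.
by [].
Qed.

Definition spine t : book phi := book_point t (0, 0)%N 0.

Lemma height_spine t : height (spine t) = 0.
Proof. by rewrite height_point// lexx sheet_ge0. Qed.

Lemma page_spine t : page (spine t) = (0, 0)%N.
Proof. by apply: height0_page; exact: height_spine. Qed.

Lemma point0 t j : book_point t j 0 = spine t.
Proof.
have h0 : height (book_point t j 0) = 0 by rewrite height_point// lexx sheet_ge0.
by apply: book_ext; rewrite ?height_spine ?page_spine ?h0// height0_page.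
Qed.

Lemma page_dist_spine x t : page_dist x (spine t) = height x.
Proof. by rewrite /page_dist height_spine star_distC star_dist0. Qed.

Lemma eq_spine x : height x = 0 -> x = spine (pos x).
Proof.
by move=> x0; apply: book_ext; rewrite // ?height_spine ?page_spine// height0_page.
Qed.

Lemma page_dist_point t j u s l v :
  page_dist (book_point t j u) (book_point s l v) =
  star_dist j (clip t j u) l (clip s l v).
Proof.
have clip_ge0 a b c : 0 <= clip a b c by rewrite /clip le_max lexx.
rewrite /page_dist /height/= {1 2}/page/=.
case: ifPn => [/eqP u0|_]; first by rewrite u0 !star_dist0.
by case: ifPn => [/eqP u0|_] //; rewrite u0 star_distC star_dist0// star_distC star_dist0.
Qed.

(** On a common page, the minimum of [u] and [phi j t] is 1-Lipschitz for the max metric because the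
    sheet is; on different pages clipping only lowers the sum of the heights. *)
Lemma mdist_point t j u s l v : 0 <= u -> 0 <= v ->
  mdist (book_point t j u) (book_point s l v) <=
  Num.max `|t - s| (star_dist j u l v).
Proof.
move=> u0 v0; rewrite mdistE ge_max le_max lexx /= page_dist_point /clip.
have -> : Num.max 0 (Num.min u (phi j t)) = Num.min u (phi j t).
  by apply/max_idPr; rewrite le_min u0 sheet_ge0.
have -> : Num.max 0 (Num.min v (phi l s)) = Num.min v (phi l s).
  by apply/max_idPr; rewrite le_min v0 sheet_ge0.
rewrite /star_dist; have [<-|_] := eqVneq j l; last first.
  by rewrite le_max (_ : _ <= u + v) ?orbT// lerD// ge_min lexx.
have phi_lip := sheet_lip phi j t s.
have [uv1 uv2 ts1 ts2] : [/\ u - v <= `|u - v|, v - u <= `|u - v|,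
    phi j t - phi j s <= `|t - s| & phi j s - phi j t <= `|t - s|].
  split; [exact: ler_norm|rewrite distrC; exact: ler_norm| |].
    exact: le_trans (ler_norm _) phi_lip.
  by rewrite distrC in phi_lip; exact: le_trans (ler_norm _) phi_lip.
by rewrite le_max; case: (leP u); case: (leP v) => *; case: (leP `|t - s| `|u - v|) => *;
  apply/orP; (left; abs_lra) || (right; abs_lra).
Qed.

End metric.
End book.

(** * Geodesics, contraction, compactness *)

Section space.
Context {R : realType} (phi : profile R).
Implicit Types (j l : nat * nat) (t s u v : R) (x y z : book phi).

(** Both cases run at constant speed at most 1 over time [D]. Across two arms, [w] is the signed
    coordinate on their union, from [u] on arm [j] down to [- v] on arm [l]. The disjunction on
    [p D] covers [v = 0], when the path stays on [j]. *)
Lemma star_geodesic j u l v D : 0 <= u -> 0 <= v -> 0 < D ->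
  star_dist j u l v <= D -> exists (p : R -> nat * nat) (h : R -> R),
  [/\ forall a, 0 <= a <= D -> 0 <= h a,
      (p 0 = j /\ h 0 = u), h D = v /\ (v = 0 \/ p D = l) &
      forall a b, 0 <= a <= D -> 0 <= b <= D ->
        star_dist (p a) (h a) (p b) (h b) <= `|a - b|].
Proof.
move=> u0 v0 D0; rewrite {1}/star_dist; case: eqVneq => [<-|jl] uvD.
  exists (fun=> j), (fun a => u + (v - u) * (a / D)); split.
  - move=> a /andP[a0 aD].
    have : 0 <= a / D <= 1 by rewrite divr_ge0 ?(ltW D0)//= ler_pdivrMr ?mul1r.
    move: (a / D) => c; nra.
  - by rewrite mul0r mulr0 addr0.
  - by rewrite divff ?gt_eqF// mulr1 addrC subrK; split=> //; right.
  - move=> a b _ _; rewrite /star_dist eqxx.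
    rewrite (_ : _ - _ = (v - u) / D * (a - b)); last by field; rewrite gt_eqF.
    rewrite normrM ler_piMl// normrM distrC normfV (gtr0_norm D0).
    by rewrite ler_pdivrMr ?mul1r.
pose w a := u - (u + v) * (a / D).
exists (fun a => if 0 <= w a then j else l), (fun a => `|w a|); split => //.
- by rewrite /w mul0r mulr0 subr0 u0 ger0_norm.
- rewrite /w divff ?gt_eqF// mulr1.
  rewrite (_ : u - (u + v) = - v); last by ring.
  rewrite normrN ger0_norm//; split=> //; case: ifPn; last by right.
  by rewrite oppr_ge0 => v0'; left; apply/eqP; rewrite eq_le v0 v0'.
- move=> a b _ _.
  have wab : `|w a - w b| <= `|a - b|.
    rewrite (_ : _ - _ = (u + v) / D * (b - a)); last first.
      by rewrite /w; field; rewrite gt_eqF.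
    rewrite normrM distrC ler_piMl// normrM normfV (gtr0_norm D0).
    by rewrite ler_pdivrMr ?mul1r// ger0_norm// addr_ge0.
  rewrite (le_trans _ wab)//.
  rewrite /star_dist; case: (leP 0 (w a)) => ha; case: (leP 0 (w b)) => hb;
   rewrite ?eqxx ?(negbTE jl) 1?[l == j]eq_sym ?(negbTE jl)
     ?(ger0_norm ha) ?(ger0_norm hb) ?(ltr0_norm ha) ?(ltr0_norm hb) //.
  + by have := ler_norm (w a - w b); lra.
  + by rewrite distrC; have := ler_norm (w b - w a); lra.
  + by rewrite distrC opprK addrC.
Qed.

(** An affine path in the line and a path in the star, clipped to the book, give a 1-Lipschitz path
    of duration [D] between points at distance [D]. By the triangle inequality no part of it can be
    shortened, so it is isometric. *)
Lemma book_geodesic : geodesic_space (book phi).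
Proof.
move=> x y; have := mdist_ge0 x y; rewrite le_eqVlt => /orP[/eqP/esym xy0|D0].
  exists (fun=> x); rewrite xy0; split => //; first exact: mdist_positivity.
  move=> s t; rewrite !in_itv/= => s0 t0.
  by rewrite mdistxx (_ : s = t) ?subrr ?normr0//; lra.
set D := mdist x y in D0 *.
have [p [h [h0 [p0 h00] [hD pD] hp]]] := star_geodesic
  (height_ge0 x) (height_ge0 y) D0 (page_dist_mdist x y).
pose c a := book_point phi (pos x + (pos y - pos x) * (a / D)) (p a) (h a).
have c0 : c 0 = x.
  by rewrite /c mul0r mulr0 addr0 p0 h00 book_pointK.
have cD : c D = y.
  rewrite /c divff ?gt_eqF// mulr1 addrC subrK hD.
  case: pD => [hy0|->]; last exact: book_pointK.
  by rewrite hy0 point0 [in RHS](eq_spine hy0).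
have clip a b : 0 <= a <= D -> 0 <= b <= D -> mdist (c a) (c b) <= `|a - b|.
  move=> aD bD; rewrite /c (le_trans (mdist_point _ _ _ _ _ _ _))//.
  - by apply: h0.
  - by apply: h0.
  rewrite ge_max hp// andbT.
  rewrite (_ : _ - _ = (pos y - pos x) / D * (a - b)); last first.
    by field; rewrite gt_eqF.
  rewrite normrM ler_piMl// normrM distrC normfV (gtr0_norm D0).
  by rewrite ler_pdivrMr ?mul1r// pos_mdist.
have clip' a b : 0 <= a <= D -> 0 <= b <= D -> a <= b ->
    mdist (c a) (c b) = b - a.
  move=> aD bD ab; apply/eqP; rewrite eq_le; apply/andP; split.
    by rewrite (le_trans (clip _ _ aD bD))// distrC ger0_norm// subr_ge0.
  have D0D : 0 <= (0 : R) <= D by apply/andP; split=> //; exact: ltW.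
  have DDD : 0 <= D <= D by apply/andP; split=> //; exact: ltW.
  have := clip _ _ D0D aD; have := clip _ _ bD DDD; rewrite c0 cD.
  rewrite sub0r normrN (ger0_norm (_ : 0 <= a)); last by case/andP: aD.
  rewrite distrC ger0_norm; last by rewrite subr_ge0; case/andP: bD.
  have := metric_triangle x (c a) y; have := metric_triangle (c a) (c b) y.
  by rewrite -/D; lra.
exists c; split => // a b; rewrite !in_itv/= => aD bD.
have [ab|/ltW ba] := leP a b; first by rewrite clip'// distrC ger0_norm// subr_ge0.
by rewrite metric_sym clip'// ger0_norm// subr_ge0.
Qed.

(** The function [1 - a] clamped to the unit interval is defined on all of [R], so the contracting
    homotopy is continuous everywhere. *)
Lemma clamped_decay : exists c : R -> R, [/\ c 0 = 1, c 1 = 0,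
  forall a, 0 <= c a <= 1 & forall a b, `|c a - c b| <= `|a - b|].
Proof.
pose c (a : R) : R := Num.max 0 (Num.min 1 (1 - a)).
have c01 a : 0 <= c a <= 1.
  by rewrite /c le_max lexx/= ge_max ler01 ge_min lexx.
have clip a b : `|c a - c b| <= `|a - b|.
  have h1 := ler_norm (a - b); have h2 := ler_norm (b - a); rewrite distrC in h2.
  have cE d : [\/ d <= 0 /\ c d = 1, (0 <= d /\ d <= 1) /\ c d = 1 - d |
      1 <= d /\ c d = 0].
    have [d0|/ltW d0] := leP d 0.
      apply: Or31; split=> //; rewrite /c (_ : Num.min 1 _ = 1).
        by apply/max_idPr.
      by apply/min_idPl; lra.
    rewrite /c (_ : Num.min 1 _ = 1 - d); last by apply/min_idPr; lra.
    have [d1|/ltW d1] := leP d 1.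
      by apply: Or32; split=> //; apply/max_idPr; lra.
    by apply: Or33; split=> //; apply/max_idPl; lra.
  by case: (cE a) => -[ha ->]; case: (cE b) => -[hb ->]; abs_lra.
exists c; split => //; rewrite /c.
- by rewrite subr0 minxx; apply/max_idPr.
- by rewrite subrr (_ : Num.min 1 0 = 0) ?maxxx//; apply/min_idPr.
Qed.

(** Position and height are scaled together; clipping corrects heights that exceed the page at the
    new position. *)
Lemma book_contractible : contractible (book phi).
Proof.
have [c [c0 c1 c01 clip]] := clamped_decay.
exists (spine phi 0).
exists (fun p => book_point phi (c p.2 * pos p.1) (page p.1) (c p.2 * height p.1)).
split; last 2 first.
- by move=> x /=; rewrite c0 !mul1r book_pointK.
- by move=> x /=; rewrite c1 !mul0r point0.
apply: continuous_subspaceT => -[x a].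
apply/cvgrPdist_lt => e e0.
have M0 : 0 < `|pos x| + 1 by rewrite ltr_pwDr.
have bound (p : book phi * R) :
    mdist (book_point phi (c a * pos x) (page x) (c a * height x))
      (book_point phi (c p.2 * pos p.1) (page p.1) (c p.2 * height p.1)) <=
    (`|pos x| + 1) * `|a - p.2| + mdist x p.1.
  case: p => y b /=; have hx := height_ge0 x; have hy := height_ge0 y.
  have /andP[ca0 ca1] := c01 a; have /andP[cb0 cb1] := c01 b.
  have chx d : 0 <= c d * height x by move: (height_ge0 x); case/andP: (c01 d) => *; exact: mulr_ge0.
  have chy : 0 <= c b * height y by exact: mulr_ge0 cb0 (height_ge0 y).
  (* The intermediate point changes the parameter but keeps [x]. The remaining move, from [x] to [y]
     at parameter [b], is nonexpansive because [c b] is at most 1. *)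
  set m := book_point phi (c b * pos x) (page x) (c b * height x).
  rewrite (le_trans (metric_triangle _ m _))// lerD//.
    rewrite (le_trans (mdist_point _ _ _ _ _ _ _))// /star_dist eqxx.
    rewrite -!mulrBl !normrM. rewrite -maxr_pMr// mulrC ler_pM// ?le_max ?normr_ge0//.
    rewrite ge_max lerDl ler01/= ger0_norm//.
    have := height_le x; have := sheet_le_half phi (page x) (pos x).
    by have := normr_ge0 (pos x); lra.
  rewrite /m (le_trans (mdist_point _ _ _ _ _ _ _))//.
  rewrite ge_max -mulrBr normrM (ger0_norm cb0); apply/andP; split.
    by rewrite (le_trans _ (pos_mdist _ _))// ler_piMl.
  rewrite (le_trans _ (page_dist_mdist _ _))// /page_dist /star_dist.
  case: ifP => _; last by rewrite -mulrDr ler_piMl// addr_ge0.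
  by rewrite -mulrBr normrM (ger0_norm cb0) ler_piMl.
have e2 : 0 < e / 2 by rewrite divr_gt0.
have e3 : 0 < (`|pos x| + 1)^-1 * (e / 2) by rewrite mulr_gt0// invr_gt0.
have : nbhs x (fun y => mdist x y < e / 2).
  by apply/(@nbhs_mdistP R (book phi)); exists (e / 2).
have : nbhs a (fun b => `|a - b| < (`|pos x| + 1)^-1 * (e / 2)).
  by exists ((`|pos x| + 1)^-1 * (e / 2)).
move=> Na Nx.
exists ([set y | mdist x y < e / 2],
  [set b | `|a - b| < (`|pos x| + 1)^-1 * (e / 2)]) => //.
move=> -[y b] [/= xy ab]; apply: (le_lt_trans (bound (y, b))).
by rewrite [e]splitr ltrD// -ltr_pdivlMl.
Qed.

Lemma book_point_continuous j :
  continuous (fun p : R * R => book_point phi p.1 j `|p.2|).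
Proof.
move=> -[t u]; apply/cvgrPdist_lt => e e0.
exists ([set s | `|t - s| < e], [set v | `|u - v| < e]); first by split; exists e.
move=> -[s v] [/= ts uv].
rewrite (le_lt_trans (mdist_point _ _ _ _ _ (normr_ge0 _) (normr_ge0 _)))//.
rewrite /star_dist eqxx gt_max ts/=.
by rewrite (le_lt_trans _ uv)// ler_dist_dist.
Qed.

Lemma sheet_compact j (M : R) :
  compact ((fun p : R * R => book_point phi p.1 j `|p.2|) @`
    (`[- M, M] `*` `[0, 1])).
Proof.
apply: continuous_compact; last by apply: compact_setX; exact: segment_compact.
exact: continuous_subspaceT (@book_point_continuous j).
Qed.

Lemma cvg_cball (F : set_system (book phi)) x r z : ProperFilter F ->
  F (cball x r) -> F --> z -> cball x r z.
Proof.
move=> PF Fx /fcvgrPdist_lt Fz; rewrite /cball /=.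
apply/ler_addgt0Pl => e e0.
have [y [/= xy zy]] := filter_ex (filterI Fx (Fz _ e0)).
rewrite (le_trans (metric_triangle x y z))// addrC lerD//.
by rewrite metric_sym ltW.
Qed.

(** An ultrafilter on a ball either lives on one page, inside the compact image of a rectangle, or
    leaves every finite set of pages. In the latter case heights tend to 0 and it converges to a
    spine point. *)
Lemma book_proper : proper_space (book phi).
Proof.
move=> x r; rewrite compact_ultra => F UF Fx.
have PF : ProperFilter F by exact: ultra_proper.
suff [z Fz] : exists z, F --> z by exists z; split => //; exact: cvg_cball Fz.
pose M : R := `|pos x| + r.
have cballM y : cball x r y -> - M <= pos y <= M.
  move=> xy; rewrite -ler_norml.
  have := le_trans (pos_mdist x y) xy; rewrite distrC.
  by have := ler_normD (pos y - pos x) (pos x); rewrite subrK /M; lra.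
have [[j Fj]|noj] := pselect (exists j, F [set y | page y = j]).
  have := @sheet_compact j M; rewrite compact_ultra => /(_ F UF)[|z [_ Fz]];
    last by exists z.
  apply: filterS (filterI Fx Fj) => y [/cballM yM /= yj].
  exists (pos y, height y) => /=.
    rewrite !in_itv/= yM height_ge0 (le_trans (height_le y))//.
    by rewrite (le_trans (sheet_le_half _ _ _))//; lra.
  by rewrite ger0_norm ?height_ge0// -yj book_pointK.
have Fnot (s : seq (nat * nat)) : F [set y | page y \notin s].
  elim: s => [|j s IH]; first by apply: filterS filterT => y.
  have [Fj|Fj] := in_ultra_setVsetC [set y | page y = j] UF.
    by exfalso; apply: noj; exists j.
  apply: filterS (filterI Fj IH) => y [/= /eqP yj ys].
  by rewrite inE negb_or yj.
have Flow e : 0 < e -> F [set y | height y <= e].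
  move=> /sheet_finite-/(_ phi)[s hs]; apply: filterS (Fnot s) => y /hs ys /=.
  exact: le_trans (height_le y) (ys _).
have FM : (@pos R phi @ F) [set` `[- M, M]].
  suff : F (@pos R phi @^-1` [set` `[- M, M]]) by [].
  by apply: filterS Fx => y /cballM; rewrite /= in_itv.
have [t0 [_ clt0]] :=
  @segment_compact R (- M) M _ (fmap_proper_filter (@pos R phi) PF) FM.
(* For an ultrafilter a cluster point is a limit, and small heights turn the cluster point [t0] of
   the positions into one of [F]. *)
exists (spine phi t0); have := @ultra_cvg_clusterE _ F UF.
move=> /seteqP[+ _] => /(_ (spine phi t0)); apply => A B FA.
move=> /nbhs_mdistP[e /= e0 eB].
have e20 : 0 < e / 2 by rewrite divr_gt0.
have FAe : F (A `&` [set y | height y <= e / 2]) 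
  by apply: filterI => //; exact: Flow.
have Fe : (@pos R phi @ F) (@pos R phi @` (A `&` [set y | height y <= e / 2])).
  suff : F (@pos R phi @^-1` (@pos R phi @` (A `&` [set y | height y <= e / 2]))).
    by [].
  by apply: filterS FAe => y yA; exists y.
have Ne : nbhs t0 [set s | `|t0 - s| < e] by exists e.
have [_ [[y [Ay ye] <-] /= ty]] := clt0 _ _ Fe Ne.
exists y; split => //; apply: eB => /=; rewrite metric_sym.
apply/mdist_ltP; rewrite distrC page_dist_spine; split=> //.
by move: ye => /=; lra.
Qed.

End space.

(** * Isometries between balls *)

Section intrinsic.
Context {R : realType}.

(** Each path in [A] is carried to a path in [B] of the same length, so the infimum on the left runs
    over at least as many lengths. *)
Lemma intrinsic_dist_le (X Y : metricType R) (A : set X) (B : set Y)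
    (f : X -> Y) (a b : X) :
  (forall x, A x -> B (f x)) ->
  (forall x y, A x -> A y -> mdist (f x) (f y) = mdist x y) ->
  (intrinsic_dist B (f a) (f b) <= intrinsic_dist A a b)%E.
Proof.
move=> fAB fd; apply: ereal_inf_le_tmp => _ [c [cc c0 c1 cA] <-].
have cA' t : 0 <= t <= 1 -> A (c t).
  by move=> t01; apply: cA; exists t => //; rewrite /= in_itv.
exists (f \o c).
  split; rewrite /= ?c0 ?c1//; last first.
    by move=> _ [t + <-]; rewrite /= in_itv/= => /cA' /fAB.
  apply/subspace_continuousP => t; rewrite /= in_itv/= => t01.
  move/subspace_continuousP : cc => /(_ t).
  rewrite /= in_itv/= => /(_ t01) /cvgrPdist_lt ct.
  apply/cvgrPdist_lt => e /ct; rewrite !near_withinE; apply: filterS => s.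
  by rewrite /= in_itv/= => /[swap] s01 /(_ s01); rewrite fd//; exact: cA'.
rewrite /path_length; congr ereal_sup; apply: eq_imagel => s sp.
congr (_%:E); rewrite /polygonal_length; apply: eq_big_nat => n /andP[_ ns] /=.
have c01 m : (m < (size s).+1)%N -> A (c (nth 1 (0 :: s) m)).
  move=> ms; apply: cA'; rewrite (itv_partition_nth_ge ms sp).
  exact: itv_partition_nth_le ms sp.
by rewrite fd//; [exact: (c01 n (ltnW ns))|exact: (c01 n.+1 ns)].
Qed.

(** Reduces the comparison of intrinsic metrics to ambient distances: the previous inequality is
    applied to [f] and to [g]. *)
Lemma mdist_intrinsically_isometric (X Y : metricType R) (A : set X) (B : set Y)
    (f : X -> Y) (g : Y -> X) :
  (forall x, A x -> B (f x)) -> (forall y, B y -> A (g y)) ->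
  (forall x, A x -> g (f x) = x) -> (forall y, B y -> f (g y) = y) ->
  (forall x y, A x -> A y -> mdist (f x) (f y) = mdist x y) ->
  intrinsically_isometric A B.
Proof.
move=> fAB gBA gf fg fd.
have gd x y : B x -> B y -> mdist (g x) (g y) = mdist x y.
  by move=> Bx By; rewrite -fd ?fg//; exact: gBA.
exists f.
  split => //; first by move=> x y /set_mem Ax /set_mem Ay fxy; rewrite -(gf x)// fxy gf.
  by move=> y By; exists (g y); rewrite ?fg//; exact: gBA.
move=> a b Aa Ab; apply/eqP; rewrite eq_le intrinsic_dist_le//=.
by rewrite -[in leLHS](gf a)// -[in leLHS](gf b)//; exact: intrinsic_dist_le.
Qed.

End intrinsic.

(** * Transport by a shift and a permutation of pages *)

Section transport.
Context {R : realType} (phi psi : profile R).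
Implicit Types (t c : R) (pi : nat * nat -> nat * nat) (x y : book phi).

(** Total thanks to clipping, but height and distance are preserved only over positions where
    [matching] holds. *)
Definition transport c pi x : book psi :=
  book_point psi (pos x + c) (pi (page x)) (height x).

Definition matching c pi t := forall j, psi (pi j) (t + c) = phi j t.

Lemma height_transport c pi x : matching c pi (pos x) ->
  height (transport c pi x) = height x.
Proof. by move=> m; rewrite height_point// m height_ge0 height_le. Qed.

Lemma page_transport c pi x : matching c pi (pos x) -> 0 < height x ->
  page (transport c pi x) = pi (page x).
Proof. by move=> m h; rewrite page_point// m h height_le. Qed.

Lemma mdist_transport c pi x y : injective pi ->
  matching c pi (pos x) -> matching c pi (pos y) ->
  mdist (transport c pi x) (transport c pi y) = mdist x y.
Proof.
move=> inj mx my; rewrite !mdistE page_dist_point !pos_point.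
rewrite (_ : _ - _ = pos x - pos y); last by ring.
rewrite !clip_id ?mx ?my ?height_ge0 ?height_le//.
by rewrite /page_dist /star_dist inj_eq.
Qed.

End transport.

Lemma transportK (R : realType) (phi psi : profile R) c pi pi' (x : book phi) :
  cancel pi pi' -> matching phi psi c pi (pos x) ->
  transport phi (- c) pi' (transport psi c pi x) = x.
Proof.
move=> piK m; rewrite /transport pos_point.
have -> : pos x + c - c = pos x by ring.
rewrite height_transport//; have := height_ge0 x.
rewrite le_eqVlt => /orP[/eqP/esym x0|x0].
  by rewrite x0 point0 [in RHS](eq_spine x0).
by rewrite page_transport// piK book_pointK.
Qed.

Lemma transport_isom (R : realType) (phi psi : profile R) c pi pi' :
  cancel pi pi' -> cancel pi' pi -> (forall t, matching phi psi c pi t) ->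
  bijective (@transport R phi psi c pi).
Proof.
move=> piK pi'K m; exists (@transport R psi phi (- c) pi').
  by move=> x; apply: transportK.
move=> y; rewrite -{1}(opprK c); apply: transportK => // j.
by rewrite -m pi'K subrK.
Qed.

(** Positions in a ball of radius [r] stay within [r] of the centre, so matching over that interval
    suffices; the inverse transport shows that the whole ball around the image is reached. *)
Lemma transport_cball (R : realType) (phi psi : profile R) c pi pi'
    (x0 : book phi) r :
  cancel pi pi' -> cancel pi' pi ->
  (forall t, `|pos x0 - t| <= r -> matching phi psi c pi t) ->
  0 <= r ->
  intrinsically_isometric (cball x0 r) (cball (transport psi c pi x0) r).
Proof.
move=> piK pi'K m r0.
have mx : matching phi psi c pi (pos x0) by apply: m; rewrite subrr normr0.
have m0 x : cball x0 r x -> matching phi psi c pi (pos x).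
  by move=> x0x; apply: m; rewrite (le_trans (pos_mdist _ _)).
have m' y : cball (transport psi c pi x0) r y -> matching psi phi (- c) pi' (pos y).
  move=> /(le_trans (pos_mdist _ _)); rewrite pos_point => yr j.
  by rewrite -(m (pos y - c)) ?pi'K ?subrK// opprB addrA.
have tK y : cball (transport psi c pi x0) r y ->
    transport psi c pi (transport phi (- c) pi' y) = y.
  by move=> yr; rewrite -{1}(opprK c); apply: transportK => //; apply: m'.
have inj := can_inj piK; have inj' := can_inj pi'K.
apply: (@mdist_intrinsically_isometric _ _ _ _ _
  (@transport R phi psi c pi) (@transport R psi phi (- c) pi')).
- by move=> x x0x; rewrite /cball/= mdist_transport//; exact: m0.
- move=> y yr; rewrite /cball/= -(transportK piK mx) mdist_transport//.
    apply: m'; rewrite /cball/= mdistxx//.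
  exact: m'.
- by move=> x /m0 x0x; apply: transportK.
- exact: tK.
- by move=> x y /m0 ? /m0 ?; apply: mdist_transport.
Qed.

Lemma transport_cball_onto (R : realType) (phi psi : profile R) c pi pi'
    (y0 : book psi) r :
  cancel pi pi' -> cancel pi' pi -> 0 <= r ->
  (forall t, `|pos y0 - c - t| <= r -> matching phi psi c pi t) ->
  intrinsically_isometric (cball (transport phi (- c) pi' y0) r) (cball y0 r).
Proof.
move=> piK pi'K r0 m.
have my : matching psi phi (- c) pi' (pos y0).
  by move=> j; rewrite -(m (pos y0 - c)) ?pi'K ?subrK// subrr normr0.
have {2}<- : transport psi c pi (transport phi (- c) pi' y0) = y0.
  by rewrite -{1}(opprK c); apply: transportK.
exact: transport_cball.
Qed.

(** * Structure of isometries *)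

Section isometry.
Context {R : realType}.

Section one_way.
Context {phi psi : profile R} (g : book phi -> book psi).
Hypothesis gd : forall x y, mdist (g x) (g y) = mdist x y.
Implicit Types (x y z : book phi) (t : R) (j : nat * nat).

Lemma mdist_far (chi : profile R) (x y : book chi) : 1 < mdist x y ->
  mdist x y = `|pos x - pos y|.
Proof.
rewrite mdistE lt_max => /orP[xy|]; last first.
  have := star_dist_le (page x) (page y) (height_ge0 x) (height_ge0 y).
  have := le_trans (height_le x) (sheet_le_half _ _ _).
  have := le_trans (height_le y) (sheet_le_half _ _ _).
  by rewrite /page_dist; lra.
apply/max_idPl; rewrite (le_trans _ (ltW xy))//.
have := star_dist_le (page x) (page y) (height_ge0 x) (height_ge0 y).
have := le_trans (height_le x) (sheet_le_half _ _ _).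
have := le_trans (height_le y) (sheet_le_half _ _ _).
by rewrite /page_dist; lra.
Qed.

Lemma isometry_pos_far x y : 1 < `|pos x - pos y| ->
  pos (g x) - pos (g y) = pos x - pos y \/ pos (g x) - pos (g y) = pos y - pos x.
Proof.
move=> xy; have xy' : 1 < mdist x y by rewrite (lt_le_trans xy)// pos_mdist.
have : `|pos (g x) - pos (g y)| = `|pos x - pos y|.
  by rewrite -!mdist_far// gd.
by move=> /eqP; rewrite eqr_norm2 opprB => /orP[] /eqP; [left|right].
Qed.

(** Distances above 1 are differences of positions, so far pairs fix positions up to sign. The
    anchors 0 and 3 determine the sign and settle all points far from both; the remaining positions,
    in [[-1, 4]], are compared with 10 and -10. *)
Lemma isometry_pos : exists s c : R, (s = 1 \/ s = -1) /\
  forall x, pos (g x) = s * pos x + c.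
Proof.
pose p t := pos (g (spine phi t)).
have far x t : 1 < `|pos x - t| ->
    pos (g x) - p t = pos x - t \/ pos (g x) - p t = t - pos x.
  exact: (@isometry_pos_far x (spine phi t)).
have gt1 (a : R) : 1 < a \/ a < -1 -> 1 < `|a|.
  by move=> [|] a1; [rewrite gtr0_norm|rewrite ltr0_norm]; lra.
have [s [s1 p3]] : exists s : R, (s = 1 \/ s = -1) /\ p 3 - p 0 = s * 3.
  have [||] := far (spine phi 3) 0; rewrite ?pos_point /p.
  - by apply: gt1; lra.
  - by exists 1; split; [left|lra].
  - by exists (-1); split; [right|lra].
exists s, (p 0); split => //.
have medium x : (1 < pos x \/ pos x < -1) -> (1 < pos x - 3 \/ pos x - 3 < -1) ->
    pos (g x) = s * pos x + p 0.
  move=> x0 x3.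
  have [||] := far x 0; first by apply: gt1; rewrite subr0.
  - have [||] := far x 3; [exact: gt1| |]; case: s1 p3 => ->; case: x0 => ?; case: x3 => ?; lra.
  - have [||] := far x 3; [exact: gt1| |]; case: s1 p3 => ->; case: x0 => ?; case: x3 => ?; lra.
move=> x; have [x4|x4] := ltP 4 (pos x); first by apply: medium; lra.
have [x1|x1] := ltP (pos x) (-1); first by apply: medium; lra.
have p10 : p 10 = s * 10 + p 0 by apply: (medium (spine phi 10)); rewrite pos_point; lra.
have m10 : p (-10) = s * (-10) + p 0.
  by apply: (medium (spine phi (-10))); rewrite pos_point; lra.
have [||] := far x 10; first (by apply: gt1; lra);
  (have [||] := far x (-10); first (by apply: gt1; lra)); case: s1 p10 m10 => ->; lra.
Qed.

End one_way.

(** * Branch points and the spine *)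

(** A point at positive height cuts the star in two: the outer part of its arm and the rest. The
    boolean tells the sides apart, and points with the cut point strictly between them lie on
    opposite sides. *)
Lemma star_branch (j l k : nat * nat) (u v w : R) : 0 < u -> 0 <= v -> 0 <= w ->
  star_dist l v k w = star_dist l v j u + star_dist j u k w ->
  0 < star_dist l v j u -> 0 < star_dist j u k w ->
  ((l == j) && (u < v)) != ((k == j) && (u < w)).
Proof.
move=> u0 v0 w0; rewrite /star_dist [j == k]eq_sym.
have [->|lj] := eqVneq l j; last first.
  have [->|kj] := eqVneq k j; last first.
    case: ifP => [_|_]; last lra.
    by have := ler_norm (v - w); have := ler_norm (w - v); rewrite [`|w - v|]distrC;
     case: (leP 0 (v - w)) => h; rewrite ?(ger0_norm h) ?(ltr0_norm h); lra.
  rewrite ?eqxx ?(negbTE lj) /=; case: (ltP u w) => // wu.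
  by rewrite (ger0_norm (_ : 0 <= u - w)) ?subr_ge0//; lra.
rewrite ?eqxx /=; have [kj|kj] := eqVneq k j; last first.
  case: (ltP u v) => //= vu; rewrite distrC ger0_norm ?subr_ge0//; lra.
case: (ltP u v) => vu; case: (ltP u w) => wu //=.
all: case: (leP 0 (v - w)) => h1; case: (leP 0 (v - u)) => h2;
  case: (leP 0 (u - w)) => h3; rewrite ?(ger0_norm h1) ?(ltr0_norm h1)
    ?(ger0_norm h2) ?(ltr0_norm h2) ?(ger0_norm h3) ?(ltr0_norm h3); lra.
Qed.

(** The three points are taken in the fibre of [z], where the metric is that of a star. In the max
    metric of a plane, [(1, 1)], [(-1, 1)] and [(-1, -1)] surround the origin in the same way, so
    without this interior points of pages would branch too. *)
Definition branching (phi : profile R) (z : book phi) :=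
  exists p1 p2 p3 : book phi,
  [/\ [/\ pos p1 = pos z, pos p2 = pos z & pos p3 = pos z],
    [/\ 0 < mdist p1 z, 0 < mdist p2 z & 0 < mdist p3 z] &
    [/\ mdist p1 p2 = mdist p1 z + mdist z p2,
        mdist p2 p3 = mdist p2 z + mdist z p3 &
        mdist p1 p3 = mdist p1 z + mdist z p3]].

(** Off the spine there are only two sides, so three points cannot lie on pairwise different
    ones. *)
Lemma branching_height (phi : profile R) (z : book phi) :
  branching z -> height z = 0.
Proof.
move=> [p1 [p2 [p3 [[z1 z2 z3] [n1 n2 n3] [d12 d23 d13]]]]].
have := height_ge0 z; rewrite le_eqVlt => /orP[/eqP//|z0]; exfalso.
have sep p q : pos p = pos z -> pos q = pos z -> 0 < mdist p z ->
    0 < mdist q z -> mdist p q = mdist p z + mdist z q ->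
    ((page p == page z) && (height z < height p)) !=
    ((page q == page z) && (height z < height q)).
  move=> pz qz; rewrite [mdist q z]metric_sym.
  rewrite !mdist_fiber ?pz ?qz// => np nq pq.
  exact: (star_branch z0 (height_ge0 p) (height_ge0 q) pq np nq).
have := sep _ _ z1 z2 n1 n2 d12; have := sep _ _ z2 z3 n2 n3 d23.
have := sep _ _ z1 z3 n1 n3 d13.
by do 3 (case: (_ && _)).
Qed.

Lemma spine_branching (phi : profile R) t : branching (spine phi t).
Proof.
have [j1 [j2 [j3 [n12 n23 n13 /(_ t)[h1 h2 h3]]]]] := sheet_three phi.
pose p j := book_point phi t j (phi j t).
have hp j : height (p j) = phi j t by rewrite height_point// sheet_ge0 lexx.
have pp j : 0 < phi j t -> page (p j) = j by move=> j0; rewrite page_point// j0 lexx.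
have dp j : mdist (p j) (spine phi t) = phi j t.
  by rewrite mdist_fiber// page_dist_spine hp.
have dpp j l : 0 < phi j t -> 0 < phi l t -> j != l ->
    mdist (p j) (p l) = mdist (p j) (spine phi t) + mdist (spine phi t) (p l).
  move=> j0 l0 jl; rewrite [mdist (spine _ _) _]metric_sym !dp mdist_fiber//.
  by rewrite /page_dist !hp !pp// /star_dist (negbTE jl).
by exists (p j1), (p j2), (p j3); split; [|rewrite !dp|split; apply: dpp].
Qed.

(** * Action of an isometry on spine, heights and pages *)

Section structure.
Context {phi psi : profile R} (g : book phi -> book psi) (s c : R).
Hypothesis gd : forall x y, mdist (g x) (g y) = mdist x y.
Hypothesis gpos : forall x, pos (g x) = s * pos x + c.
Implicit Types (x y z : book phi) (t : R) (j : nat * nat).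

Lemma isometry_branching z : branching z -> branching (g z).
Proof.
move=> [p1 [p2 [p3 [[z1 z2 z3] n d]]]].
by exists (g p1), (g p2), (g p3); rewrite !gd !gpos z1 z2 z3.
Qed.

Lemma isometry_spine t : g (spine phi t) = spine psi (s * t + c).
Proof.
rewrite [LHS]eq_spine ?gpos//.
exact/branching_height/isometry_branching/spine_branching.
Qed.

(** Height is the distance to the spine point at the same position, and both are respected by
    [g]. *)
Lemma isometry_height x : height (g x) = height x.
Proof.
have heightE (chi : profile R) (y : book chi) :
    height y = mdist y (spine chi (pos y)).
  by rewrite mdist_fiber// page_dist_spine.
by rewrite heightE [in RHS]heightE gpos -isometry_spine gd.
Qed.

(** Points on different pages are at least the sum of their heights apart, so nearby points of one
    page cannot be separated. *)
Lemma isometry_page_step x y : page x = page y ->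
  `|pos x - pos y| < height x + height y -> 0 < height x -> 0 < height y ->
  page (g x) = page (g y).
Proof.
move=> pxy txy x0 y0; apply/eqP; apply: contraT => gxy.
have : mdist x y < height x + height y.
  apply/mdist_ltP; split=> //; rewrite /page_dist pxy /star_dist eqxx.
  by case: (leP 0 (height x - height y)) => h;
    rewrite ?(ger0_norm h) ?(ltr0_norm h); lra.
rewrite ltNge -gd (le_trans _ (page_dist_mdist _ _))//.
by rewrite /page_dist !isometry_height /star_dist (negbTE gxy).
Qed.

Lemma isometry_page : exists pi : nat * nat -> nat * nat,
  forall x, 0 < height x -> page (g x) = pi (page x).
Proof.
suff /choice[pi pij] : forall j, exists l, forall x, page x = j -> 0 < height x ->
    page (g x) = l.
  by exists pi => x x0; apply: pij.
move=> j; have [[b b0 bj]|j0] := sheet_dichotomy phi j; last first.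
  by exists j => x xj x0; exfalso; have := height_le x; rewrite xj j0; lra.
pose p t := book_point phi t j b.
have hp t : height (p t) = b by rewrite height_point// ltW//= bj.
have pp t : page (p t) = j by rewrite page_point// b0 bj.
exists (page (g (p 0))) => x xj x0.
transitivity (page (g (p (pos x)))).
  by apply: isometry_page_step; rewrite ?hp ?pp// pos_point subrr normr0; lra.
(* The horizontal line at height [b] is followed in steps of length at most [b], less than the sum
   [b + b] of the heights. *)
have chain N : forall t, `|t| <= N%:R * b -> page (g (p t)) = page (g (p 0)).
  elim: N => [t|N IH t tN].
    by rewrite mul0r normr_le0 => /eqP ->.
  have N1 : 0 < N.+1%:R :> R by rewrite ltr0n.
  have tb : `|t| / N.+1%:R <= b by rewrite ler_pdivrMr// mulrC.
  have tE : t = N.+1%:R * (t / N.+1%:R) by rewrite mulrC divfK// gt_eqF.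
  have tN' : `|t / N.+1%:R| <= b by rewrite normrM normfV (gtr0_norm N1).
  rewrite -(IH (N%:R * (t / N.+1%:R))); last first.
    by rewrite normrM ger0_norm// ler_wpM2l.
  apply: isometry_page_step; rewrite ?hp ?pp// !pos_point.
  rewrite [X in `|X - _|]tE -natr1 mulrDl mul1r addrC addKr natr1.
  by rewrite (le_lt_trans tN')// ltrDl.
apply: (chain (Num.truncn (`|pos x| / b)).+1).
by rewrite -ler_pdivrMr// ltW// truncnS_gt.
Qed.

End structure.

Theorem isometry_structure (phi psi : profile R) (g : book phi -> book psi) :
  bijective g -> (forall x y, mdist (g x) (g y) = mdist x y) ->
  exists (s c : R) (pi pi' : nat * nat -> nat * nat),
  [/\ s = 1 \/ s = -1, forall x, pos (g x) = s * pos x + c,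
      forall x, height (g x) = height x,
      forall x, 0 < height x -> page (g x) = pi (page x) &
      forall j t, 0 < phi j t ->
        psi (pi j) (s * t + c) = phi j t /\ pi' (pi j) = j].
Proof.
move=> [h gK hK] gd.
have hd x y : mdist (h x) (h y) = mdist x y by rewrite -gd !hK.
have [s [c [s1 gpos]]] := isometry_pos gd.
have [s' [c' [s1' hpos]]] := isometry_pos hd.
have [pi gpage] := isometry_page gd gpos.
have [pi' hpage] := isometry_page hd hpos.
have gh := isometry_height gd gpos; have hh := isometry_height hd hpos.
exists s, c, pi, pi'; split => // j t j0.
pose x := book_point phi t j (phi j t).
have xh : height x = phi j t by rewrite height_point// lexx sheet_ge0.
have xp : page x = j by rewrite page_point// j0 lexx.
have le_psi : phi j t <= psi (pi j) (s * t + c).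
  by have := height_le (g x); rewrite gh gpage ?xh// xp gpos pos_point.
have piK : pi' (pi j) = j.
  by rewrite -[in LHS]xp -gpage ?xh// -hpage ?gh ?xh// gK xp.
split => //; apply/eqP; rewrite eq_le le_psi andbT.
(* The top of the image page, pulled back by [h], gives the reverse inequality. *)
pose y := book_point psi (s * t + c) (pi j) (psi (pi j) (s * t + c)).
have y0 : 0 < psi (pi j) (s * t + c) by rewrite (lt_le_trans j0).
have yh : height y = psi (pi j) (s * t + c) by rewrite height_point// lexx sheet_ge0.
have yp : page y = pi j by rewrite page_point// y0 lexx.
have := height_le (h y); rewrite hh hpage ?yh// yp piK hpos pos_point.
suff -> : s' * (s * t + c) + c' = t by [].
by have := hpos (g x); rewrite gK gpos !pos_point.
Qed.

End isometry.

(** * Profiles of labellings *)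

Section bump.
Context {R : realType}.
Implicit Types (A B : set R) (t s a : R).

(** The upper envelope of tents of height 1 and slope 1 centred at [A]; the value 0 is included to
    cover empty [A] and points far from it. *)
Definition bump A t : R := sup [set y | y = 0 \/ exists2 a, A a & y = 1 - `|t - a|].

Lemma bump_le A t M : 0 <= M -> (forall a, A a -> 1 - `|t - a| <= M) ->
  bump A t <= M.
Proof.
move=> M0 AM; apply: ge_sup; first by exists 0; left.
by move=> _ [->//|[a Aa ->]]; exact: AM.
Qed.

Let bump_has_ub A t :
  has_ubound [set y | y = 0 \/ exists2 a, A a & y = 1 - `|t - a|].
Proof.
by exists 1 => _ [->|[a _ ->]]; rewrite ?ler01// gerBl.
Qed.

Lemma bump_ge0 A t : 0 <= bump A t.
Proof. by apply: ub_le_sup => //; left. Qed.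

Lemma bump_ge A t a : A a -> 1 - `|t - a| <= bump A t.
Proof. by move=> Aa; apply: ub_le_sup => //; right; exists a. Qed.

Lemma bump_le1 A t : bump A t <= 1.
Proof. by apply: bump_le => // a _; rewrite gerBl. Qed.

Lemma bump_lip A t s : `|bump A t - bump A s| <= `|t - s|.
Proof.
have le t' s' : bump A t' <= bump A s' + `|t' - s'|.
  apply: bump_le => [|a Aa]; first by rewrite addr_ge0// bump_ge0.
  rewrite (le_trans _ (lerD (bump_ge s' Aa) (lexx _)))//.
  by have := ler_distD t' s' a; rewrite [`|s' - t'|]distrC; lra.
have := le t s; have := le s t; rewrite [`|s - t|]distrC => h1 h2.
by abs_lra.
Qed.

(** Only marks at distance less than 1 count, which makes heights depend locally on labels. *)
Lemma bump_mono A B t s :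
  (forall a, A a -> `|t - a| < 1 -> exists2 b, B b & `|s - b| = `|t - a|) ->
  bump A t <= bump B s.
Proof.
move=> AB; apply: bump_le => [|a Aa]; first exact: bump_ge0.
have [ta|ta] := ltP `|t - a| 1; last first.
  by rewrite (le_trans _ (bump_ge0 _ _))// subr_le0.
by have [b Bb <-] := AB a Aa ta; exact: bump_ge.
Qed.

Lemma bump_mem A t : A t -> bump A t = 1.
Proof.
move=> At; apply/eqP; rewrite eq_le bump_le1/=.
by have := bump_ge t At; rewrite subrr normr0 subr0.
Qed.

Lemma integer_gap s : exists2 d : R, 0 < d &
  forall m : int, m%:~R != s -> d <= `|s - m%:~R|.
Proof.
have /andP[] := Num.Theory.floor_itv s; set n := Num.floor s.
rewrite le_eqVlt intrD => /orP[/eqP ns _|ns sn].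
  exists 1 => // m; rewrite -ns eqr_int => mn.
  by rewrite -intrB -intr_norm -[1]/(1%:~R) ler_int -gtz0_ge1 normr_gt0 subr_eq0 eq_sym.
exists (Num.min (s - n%:~R) (n%:~R + 1 - s)).
  by rewrite lt_min !subr_gt0 ns.
move=> m _; rewrite ge_min; have [mn|nm] := leP m n.
  apply/orP; left; rewrite (le_trans _ (ler_norm _))// lerB// ler_int//.
have : (n + 1)%:~R <= m%:~R :> R by rewrite ler_int; lia.
rewrite intrD => nm'.
by apply/orP; right; rewrite distrC (le_trans _ (ler_norm _))// lerB.
Qed.

(** Marks lie in a translate of the integers, so a point that is not a mark keeps a positive
    distance from all of them and the supremum stays below 1. *)
Lemma bump_eq1 A o t : (forall a, A a -> exists n : int, a = n%:~R + o) ->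
  bump A t = 1 -> A t.
Proof.
move=> Ao At; apply: contrapT => nAt.
have [d d0 gap] := integer_gap (t - o).
have : bump A t <= Num.max 0 (1 - d).
  apply: bump_le => [|a Aa]; first by rewrite le_max lexx.
  rewrite le_max; apply/orP; right; rewrite lerB//.
  have [n an] := Ao a Aa.
  rewrite an (_ : t - (n%:~R + o) = t - o - n%:~R) ?gap//; last by ring.
  by apply: contra_notN nAt => /eqP nt; rewrite (_ : t = a)// an nt subrK.
by rewrite At le_max => /orP[]; lra.
Qed.

End bump.

(** * The profile of a labelling *)

Section label.
Context {R : realType}.

Definition amplitude (k : nat) : R := 4^-1 ^+ k.+1.

Lemma amplitude_gt0 k : 0 < amplitude k.
Proof. by rewrite exprn_gt0. Qed.

Lemma amplitudeS k : amplitude k.+1 = amplitude k / 4.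
Proof. by rewrite /amplitude exprSr. Qed.

Lemma amplitude_anti k l : (k <= l)%N -> amplitude l <= amplitude k.
Proof.
move=> kl; rewrite /amplitude ler_wiXn2l //; lra.
Qed.

Lemma amplitude_le k : amplitude k <= 4^-1.
Proof. by rewrite -[leRHS]expr1; exact: (@amplitude_anti 0). Qed.

Lemma amplitude_small e : 0 < e ->
  exists K, forall k, (K <= k)%N -> 2 * amplitude k <= e.
Proof.
move=> e0; have small k : amplitude k * k.+1%:R <= 1.
  elim: k => [|k]; first by rewrite mulr1 (le_trans (amplitude_le 0))//; lra.
  rewrite amplitudeS -(natr1 k.+1); have := amplitude_le k.
  by have := amplitude_gt0 k; have := ler0n R k.+1; nra.
exists (Num.truncn (2 / e)) => k Kk.
have : 2 / e <= k.+1%:R.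
  by rewrite (le_trans (ltW (truncnS_gt _)))// ler_nat.
rewrite ler_pdivrMr// => ek; have := small k; have := amplitude_gt0 k => a0 ak.
have k0 : 0 < k.+1%:R :> R by rewrite ltr0n.
rewrite -(ler_pM2r k0) -mulrA (le_trans (ler_wpM2l _ ak))// mulr1.
by rewrite mulrC.
Qed.

Definition offset (k : nat) : R := if k == 0%N then 3^-1 else 0.

Definition marks (x : nat -> int -> nat) (k i : nat) : set R :=
  [set n%:~R + offset k | n in [set n | x k n = i]].

Definition label_sheet (x : nat -> int -> nat) (j : nat * nat) (t : R) : R :=
  if (j.2 <= j.1)%N then amplitude j.1 * (1 + bump (marks x j.1 j.2) t) else 0.

Variable x : nat -> int -> nat.

Lemma label_sheetE k i t : (i <= k)%N ->
  label_sheet x (k, i) t = amplitude k * (1 + bump (marks x k i) t).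
Proof. by rewrite /label_sheet /= => ->. Qed.

Lemma label_sheet_out k i t : (k < i)%N -> label_sheet x (k, i) t = 0.
Proof. by move=> ki; rewrite /label_sheet /= leqNgt ki. Qed.

Lemma label_sheet_ge k i t : (i <= k)%N -> amplitude k <= label_sheet x (k, i) t.
Proof.
move=> ik; rewrite label_sheetE//.
by rewrite ler_peMr ?lerDl ?bump_ge0// ltW// amplitude_gt0.
Qed.

Lemma label_sheet_gt0 k i t : (i <= k)%N -> 0 < label_sheet x (k, i) t.
Proof. by move=> ik; rewrite (lt_le_trans (amplitude_gt0 k))// label_sheet_ge. Qed.

Lemma label_sheet_le k i t : label_sheet x (k, i) t <= 2 * amplitude k.
Proof.
have a0 := amplitude_gt0 k.
have [ik|ki] := leqP i k; last by rewrite label_sheet_out//; lra.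
rewrite label_sheetE// mulrC ler_pM2r//.
by have := bump_le1 (marks x k i) t; lra.
Qed.

Fact label_sheet_ge0 j t : 0 <= label_sheet x j t.
Proof.
case: j => k i; have [ik|ki] := leqP i k; last by rewrite label_sheet_out.
by rewrite ltW// label_sheet_gt0.
Qed.

Fact label_sheet_le_half j t : label_sheet x j t <= 2^-1.
Proof.
case: j => k i; rewrite (le_trans (label_sheet_le _ _ _))//.
by have := amplitude_le k; lra.
Qed.

Fact label_sheet_lip j t s : `|label_sheet x j t - label_sheet x j s| <= `|t - s|.
Proof.
case: j => k i; have [ik|ki] := leqP i k; last first.
  by rewrite !label_sheet_out// subrr normr0.
rewrite !label_sheetE// -mulrBr normrM opprD addrACA subrr add0r.
rewrite (le_trans _ (bump_lip (marks x k i) t s))// ler_piMl//.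
by rewrite gtr0_norm ?amplitude_gt0//; have := amplitude_le k; lra.
Qed.

Fact label_sheet_dichotomy j : (exists2 b, 0 < b & forall t, b <= label_sheet x j t)
  \/ (forall t, label_sheet x j t = 0).
Proof.
case: j => k i; have [ik|ki] := leqP i k; last first.
  by right => t; rewrite label_sheet_out.
by left; exists (amplitude k) => [|t]; [exact: amplitude_gt0|exact: label_sheet_ge].
Qed.

Fact label_sheet_finite e : 0 < e ->
  exists s : seq (nat * nat), forall j t, j \notin s -> label_sheet x j t <= e.
Proof.
move=> e0; have [K hK] := amplitude_small e0.
exists [seq (k, i) | k <- iota 0 K, i <- iota 0 K] => -[k i] t kiK.
have [ik|ki] := leqP i k; last by rewrite label_sheet_out// ltW.
rewrite (le_trans (label_sheet_le _ _ _))// hK// leqNgt.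
apply: contra kiK => kK; apply/allpairsP; exists (k, i).
by rewrite !mem_iota /= kK (leq_ltn_trans ik).
Qed.

Fact label_sheet_three : exists j1 j2 j3, [/\ j1 != j2, j2 != j3, j1 != j3 &
  forall t, [/\ 0 < label_sheet x j1 t, 0 < label_sheet x j2 t &
    0 < label_sheet x j3 t]].
Proof.
by exists (0, 0)%N, (1, 0)%N, (1, 1)%N; split=> // t; split; apply: label_sheet_gt0.
Qed.

Definition label_profile : profile R := Profile label_sheet_ge0
  label_sheet_le_half label_sheet_lip label_sheet_dichotomy label_sheet_finite
  label_sheet_three.

End label.

(** * Isometries and labels *)

Section label_isometry.
Context {R : realType}.
Implicit Types (x y : nat -> int -> nat).

Definition label_book x : metricType R := book (label_profile (R := R) x).

Definition bounded_label x := forall k n, (x k n <= k)%N.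

Lemma label_page_le x (z : book (label_profile (R := R) x)) : 0 < height z ->
  ((page z).2 <= (page z).1)%N.
Proof.
move=> z0; rewrite leqNgt; apply/negP => kz.
have := height_le z; rewrite /= /label_sheet leqNgt kz /= => hz.
by have := lt_le_trans z0 hz; rewrite ltxx.
Qed.

(** Class [k] has heights between [amplitude k] and twice that; since amplitudes decrease by a
    factor 4, these ranges are disjoint. *)
Lemma amplitude_inj k l (a b : R) : 0 <= a <= 1 -> 0 <= b <= 1 ->
  amplitude k * (1 + a) = amplitude l * (1 + b) -> k = l.
Proof.
have half i j c d : 0 <= c <= 1 -> 0 <= d <= 1 ->
    amplitude i * (1 + c) = amplitude j * (1 + d) :> R -> (j <= i)%N.
  move=> /andP[c0 c1] /andP[d0 d1] ij; rewrite leqNgt; apply/negP => ji.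
  have := @amplitude_anti R _ _ ji; rewrite amplitudeS.
  by have := @amplitude_gt0 R i; have := @amplitude_gt0 R j; nra.
by move=> a01 b01 kl; apply/eqP; rewrite eqn_leq (half _ _ _ _ a01 b01 kl) (half _ _ _ _ b01 a01)// -kl.
Qed.

Lemma intr_third (m n : int) : m%:~R + 3^-1 != n%:~R - 3^-1 :> R.
Proof.
apply/eqP => mn.
have : ((n - m) * 3)%:~R = (2 : int)%:~R :> R by rewrite intrM intrB; lra.
by move=> /eqP; rewrite eqr_int => /eqP; lia.
Qed.

Lemma mem_marks x k m : marks x k (x k m) (m%:~R + offset k : R).
Proof. by exists m. Qed.

(** A sheet reaches twice its amplitude exactly at its marks, so an isometry sends marks to marks of
    the same class. *)
Lemma label_isometry x y (g : label_book x -> label_book y) :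
  bounded_label x -> bounded_label y -> bijective g ->
  (forall z w, mdist (g z) (g w) = mdist z w) ->
  exists (n : int) (rho : nat -> nat -> nat),
  [/\ forall z, pos (g z) = pos z + n%:~R, forall z, height (g z) = height z,
      forall z, 0 < height z -> page (g z) = ((page z).1, rho (page z).1 (page z).2),
      forall k, {in [pred i | i <= k]%N &, injective (rho k)} /\
        {homo rho k : i / (i <= k)%N} &
      forall k m, y k (m + n) = rho k (x k m)].
Proof.
move=> xk yk gbij gd.
have [s [c [pi [pi' [s1 gpos gheight gpage gsheet]]]]] :=
  isometry_structure gbij gd.
have class k i : (i <= k)%N -> (pi (k, i)).1 = k /\ ((pi (k, i)).2 <= k)%N.
  move=> ik; have [eq_sheet _] := gsheet (k, i) 0 (label_sheet_gt0 x 0 ik).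
  have : (0 : R) < label_sheet y (pi (k, i)) (s * 0 + c).
    by rewrite /= in eq_sheet; rewrite eq_sheet label_sheet_gt0.
  move: eq_sheet; case: (pi (k, i)) => l j /=.
  have [jl|lj] := leqP j l; last by rewrite label_sheet_out ?ltxx.
  rewrite !label_sheetE// => lk _.
  suff <- : l = k by [].
  by apply: amplitude_inj lk; rewrite bump_ge0 bump_le1.
pose rho k i := (pi (k, i)).2.
have piE k i : (i <= k)%N -> pi (k, i) = (k, rho k i).
  by move=> /class[]; rewrite /rho; case: (pi (k, i)) => l j /= ->.
have rho_le k i : (i <= k)%N -> (rho k i <= k)%N by move=> /class[].
have mark_step k m : exists m' : int, y k m' = rho k (x k m) /\
    s * (m%:~R + offset k) + c = m'%:~R + offset k.
  have ik := xk k m.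
  have [eq_sheet _] := gsheet (k, x k m) (m%:~R + offset k) (label_sheet_gt0 x _ ik).
  move: eq_sheet; rewrite piE//= !label_sheetE ?rho_le//.
  have := @amplitude_gt0 R k; move=> a0 /(mulfI (lt0r_neq0 a0))/addrI.
  have int_marks a : marks y k (rho k (x k m)) a ->
      exists n : int, a = n%:~R + offset k :> R by move=> [n _ <-]; exists n.
  rewrite (bump_mem (mem_marks x k m)) => /(bump_eq1 int_marks)[m' ym' m'E].
  by exists m'.
(* Class 1 has offset 0, so its mark at 0 goes to an integer, which is the shift. *)
have [n [_ nE]] := mark_step 1%N 0.
have {}nE : c = n%:~R by move: nE; rewrite /offset /= !addr0 mulr0 add0r.
(* A reflection would carry the marks of class 0 from [Z + 1/3] to [Z - 1/3]. *)
have {}s1 : s = 1.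
  case: s1 => // sE; have [m [_]] := mark_step 0%N 0.
  rewrite /offset /= sE nE add0r mulN1r addrC => /eqP.
  by rewrite eq_sym (negbTE (intr_third _ _)).
exists n, rho; split => // [z|z z0|k|k m].
- by rewrite gpos s1 mul1r nE.
- rewrite gpage//; have := label_page_le z0.
  by case: (page z) => k i /= /piE.
- split=> [i i'|]; last exact: rho_le.
  rewrite !inE => ik i'k rr.
  have [_ K] := gsheet (k, i) 0 (label_sheet_gt0 x 0 ik).
  have [_ K'] := gsheet (k, i') 0 (label_sheet_gt0 x 0 i'k).
  by move: K; rewrite piE// rr -piE// K' => -[].
- have [m' [<-]] := mark_step k m.
  rewrite s1 mul1r nE -addrA [offset k + _]addrC addrA => /addIr.
  by rewrite -intrD => /eqP; rewrite eqr_int => /eqP ->.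
Qed.

Definition on_pages (rho : nat -> nat -> nat) (j : nat * nat) :=
  (j.1, rho j.1 j.2).

Lemma on_pagesK rho rho' : (forall k, cancel (rho k) (rho' k)) ->
  cancel (on_pages rho) (on_pages rho').
Proof. by move=> K [k i]; rewrite /on_pages /= K. Qed.

(** The labels need to correspond only at marks within distance 1 of [t], since no others affect the
    heights over [t]. *)
Lemma label_matching x y (n : int) rho rho' t :
  (forall k, cancel (rho k) (rho' k)) -> (forall k, cancel (rho' k) (rho k)) ->
  (forall k i, (rho k i <= k)%N = (i <= k)%N) ->
  (forall k m, `|t - (m%:~R + offset k)| < 1 -> y k (m + n) = rho k (x k m)) ->
  matching (label_profile (R := R) x) (label_profile y) n%:~R (on_pages rho) t.
Proof.
move=> K K' rho_le xy [k i]; rewrite /on_pages /= /label_sheet /= rho_le.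
case: leqP => // ik; congr (_ * (1 + _)); apply/eqP; rewrite eq_le.
apply/andP; split; apply: bump_mono => _ [m /= mi <-] tm.
- have tm' : t + n%:~R - (m%:~R + offset k) = t - ((m - n)%:~R + offset k).
    by rewrite intrB; ring.
  rewrite tm' in tm *; exists ((m - n)%:~R + offset k) => //.
  exists (m - n) => //=; apply: (can_inj (K k)).
  by rewrite -xy// subrK.
- exists ((m + n)%:~R + offset k); last first.
    by congr `|_|; rewrite intrD; ring.
  by exists (m + n) => //=; rewrite xy// mi.
Qed.

End label_isometry.

(** * Residues and windows *)

Definition swap (a b i : nat) : nat :=
  if i == a then b else if i == b then a else i.

Lemma swapK a b : involutive (swap a b).
Proof.
move=> i; rewrite /swap; case: (eqVneq i a) => [->|ia].
  by rewrite eqxx; case: eqVneq.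
by case: (eqVneq i b) => [->|ib]; rewrite ?eqxx// (negbTE ia) (negbTE ib).
Qed.

Lemma swap_le a b i k : (a <= k)%N -> (b <= k)%N -> (swap a b i <= k)%N = (i <= k)%N.
Proof.
by move=> ak bk; rewrite /swap; case: eqVneq => [->|_]; rewrite ?ak ?bk//;
  case: eqVneq => [->|_]; rewrite ?ak ?bk.
Qed.

(** On [l], [f] and [h] have the same fibres, so [f m] determines [h m] injectively. Each new
    element of [l] is accommodated by a transposition, which fixes the earlier values and preserves
    the bound [k]. *)
Lemma extend_injection (T : eqType) (l : seq T) (f h : T -> nat) k :
  (forall m, f m <= k)%N -> (forall m, h m <= k)%N ->
  {in l &, forall m m', (f m == f m') = (h m == h m')} ->
  exists rho rho' : nat -> nat, [/\ cancel rho rho', cancel rho' rho,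
    forall i, (rho i <= k)%N = (i <= k)%N & {in l, forall m, rho (f m) = h m}].
Proof.
move=> fk hk; elim: l => [|m l IH] fh; first by exists id, id; split.
have [|rho [rho' [K K' rho_le rhoE]]] := IH.
  by move=> m1 m2 m1l m2l; apply: fh; rewrite inE ?m1l ?m2l orbT.
exists (swap (rho (f m)) (h m) \o rho), (rho' \o swap (rho (f m)) (h m)); split.
- by apply: can_comp => //; exact: swapK.
- by apply: can_comp => //; exact: swapK.
- by move=> i /=; rewrite swap_le ?rho_le.
- move=> m'; rewrite inE => /predU1P[->|m'l] /=; first by rewrite /swap eqxx.
  have := fh m' m; rewrite !inE eqxx m'l orbT => /(_ isT isT).
  rewrite /swap (can_eq K) rhoE// => ->.
  by case: eqVneq => [->|].
Qed.

Lemma integer_window (R : realType) (s r : R) :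
  exists l : seq int, forall m, (m \in l) = (`|s - m%:~R| < r).
Proof.
have /andP[] := Num.Theory.floor_itv s; set n := Num.floor s => ns sn.
pose N := (Num.truncn r).+2.
exists [seq m <- [seq n - N%:Z + i%:Z | i <- iota 0 (2 * N)] | `|s - m%:~R| < r].
move=> m; rewrite mem_filter; apply/andP/idP => [[]//|sm]; split=> //.
have rN : r + 1 < N%:R by rewrite /N -natr1 ltrD2r truncnS_gt.
rewrite intrD in sn.
have [m1 m2] : s - m%:~R < r /\ m%:~R - s < r.
  by split; rewrite (le_lt_trans (ler_norm _))// distrC.
have nm : n - N%:Z <= m.
  rewrite -(ler_int R) intrB -pmulrn; lra.
have mn : m < n + N%:Z.
  rewrite -(ltr_int R) intrD -pmulrn; lra.
apply/mapP; exists (absz (m - (n - N%:Z))%R); last by lia.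
by rewrite mem_iota; lia.
Qed.

Definition residue (p : nat) (n : int) : nat := `|(n %% p%:Z)%Z|%N.

Lemma residueE p n : (0 < p)%N -> (residue p n)%:Z = (n %% p%:Z)%Z.
Proof. by move=> p0; rewrite /residue gez0_abs// modz_ge0//; lia. Qed.

Lemma residue_lt p n : (0 < p)%N -> (residue p n < p)%N.
Proof. by move=> p0; rewrite -ltz_nat residueE// ltz_pmod. Qed.

Lemma residue_id p (i : nat) : (i < p)%N -> residue p i = i.
Proof. by move=> ip; rewrite /residue modz_small. Qed.

Lemma residue_eq p n n' : (0 < p)%N ->
  (residue p n == residue p n') = (p%:Z %| n - n')%Z.
Proof. by move=> p0; rewrite -eqz_nat !residueE// eqz_mod_dvd. Qed.

Lemma residue_modD p n m : (0 < p)%N -> residue p ((residue p n)%:Z + m) = residue p (n + m).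
Proof. by move=> p0; rewrite residueE// /residue modzDml. Qed.

Lemma residue_far p n n' : (0 < p)%N -> n != n' -> residue p n = residue p n' ->
  (p <= `|n - n'|)%N.
Proof.
move=> p0 nn' /eqP; rewrite residue_eq//.
by move=> /dvdzP[q nq]; rewrite nq abszM absz_nat leq_pmull// absz_gt0; apply: contraNneq nn' => q0;
  move: nq; rewrite q0 mul0r => /eqP; rewrite subr_eq0.
Qed.

(* With [defect], position 0 of class [D] carries the extra page [D], which
   marks the origin. *)
Definition periodic_label (defect : bool) (D : nat) (p : nat -> nat)
    (k : nat) (n : int) : nat :=
  if [&& defect, k == D & n == 0] then k else residue (p k) n.

Definition periods (p : nat -> nat) := forall k, (0 < p k <= k.+1)%N.

Lemma periodic_label_le b D p : periods p ->
  forall k n, (periodic_label b D p k n <= k)%N.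
Proof.
move=> pp k n; move: pp => /(_ k)/andP[p0 pk]; rewrite /periodic_label; case: ifP => // _.
by rewrite -ltnS (leq_trans (residue_lt _ _)).
Qed.

(** Each class either equals that of the model or is injective on windows shorter than [W]; in the
    second case so is the model, whose period [k.+1] is at least [W]. *)
Definition spread (W : nat) (x : nat -> int -> nat) := forall k,
  (forall n, x k n = residue k.+1 n) \/
  (forall n n', n != n' -> x k n = x k n' -> (W <= `|n - n'|)%N) /\ (W <= k.+1)%N.

(** In class [D] the defect uses the page [D], which is no residue modulo [D], so it creates no new
    coincidence of labels. *)
Lemma periodic_label_spread W (b : bool) D p : periods p -> p D = D -> (W <= D)%N ->
  (forall k, p k = k.+1 \/ (W <= p k)%N) ->
  spread W (periodic_label b D p).
Proof.
move=> pp pD WD pW k; have /andP[p0 pk] := pp k.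
have far n n' : (W <= p k)%N -> n != n' -> residue (p k) n = residue (p k) n' ->
    (W <= `|n - n'|)%N.
  by move=> Wk nn' /(residue_far p0 nn'); apply: leq_trans.
have [kD|kD] := eqVneq k D; last first.
  have E n : periodic_label b D p k n = residue (p k) n.
    by rewrite /periodic_label (negbTE kD) andbF.
  have [pkE|Wk] := pW k; first by left => n; rewrite E pkE.
  right; split; last exact: leq_trans pk.
  by move=> n n'; rewrite !E; apply: far.
right; split; last by rewrite kD (leq_trans WD).
move=> n n' nn'; rewrite /periodic_label kD eqxx pD.
have W_D : (W <= p k)%N by rewrite kD pD.
have D0 : (0 < D)%N by rewrite -pD -kD.
have rD m : residue D m != D by rewrite neq_ltn residue_lt.
case: ifP => [/andP[_ n0]|_]; case: ifP => [/andP[_ n'0]|_].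
- by rewrite (eqP n0) (eqP n'0) eqxx in nn'.
- by move/esym/eqP; rewrite (negbTE (rD _)).
- by move/eqP; rewrite (negbTE (rD _)).
- by move=> h; apply: far => //; rewrite kD pD.
Qed.

(** * The model and its translations *)

Section assembly.
Context {R : realType}.
Implicit Types (x y : nat -> int -> nat).

Lemma label_book_good x : proper_geodesic_contractible (label_book (R := R) x).
Proof.
split; [exact: book_proper|exact: book_geodesic|exact: book_contractible].
Qed.

Definition model (k : nat) (n : int) : nat := residue k.+1 n.

Lemma model_le k n : (model k n <= k)%N.
Proof. by rewrite -ltnS; exact: residue_lt. Qed.

(** A ball of radius [r] sees only marks within [r + 1] of its centre, pairwise less than [W] apart.
    There both labellings agree or both are injective, so a permutation of each class matches them,
    with shift 0. *)
Lemma label_locally_modelled (r : R) W y : 0 <= r -> 2 * r + 2 <= W%:R ->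
  bounded_label y -> spread W y ->
  locally_modelled r (label_book (R := R) model) (label_book y).
Proof.
move=> r0 rW yk ysp y0; set t0 := pos y0.
have /choice[rho rhoP] : forall k, exists rho : (nat -> nat) * (nat -> nat),
    [/\ cancel rho.1 rho.2, cancel rho.2 rho.1,
      forall i, (rho.1 i <= k)%N = (i <= k)%N &
      forall m : int, `|t0 - offset k - m%:~R| < r + 1 ->
        rho.1 (model k m) = y k m].
  move=> k; have [l lE] := integer_window (t0 - offset k) (r + 1).
  have [|rho [rho' [K K' rho_le rhoE]]] :=
      @extend_injection _ l (model k) (y k) k (model_le k) (yk k).
    move=> m m'; rewrite !lE => lm lm'.
    have [yE|[yfar Wk]] := ysp k; first by rewrite !yE.
    have [->|mm'] := eqVneq m m'; first by rewrite !eqxx.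
    have close : (`|m - m'| < W)%N.
      rewrite -(ltr_nat R) natr_absz intr_norm intrB (lt_le_trans _ rW)//.
      have := ler_distD (t0 - offset k) (m%:~R) (m'%:~R : R).
      by rewrite [`|m%:~R - (t0 - _)|]distrC; lra.
    transitivity false; [|symmetry]; apply/negbTE/eqP => e.
      have := residue_far (ltn0Sn k) mm' e; rewrite leqNgt => /negP; apply.
      exact: leq_trans close Wk.
    by have := yfar _ _ mm' e; rewrite leqNgt close.
  by exists (rho, rho'); split=> // m; rewrite -lE; exact: rhoE.
exists (transport (label_profile model) (- (0 : int)%:~R)
  (on_pages (fun k => (rho k).2)) y0).
apply: (@transport_cball_onto _ _ _ _ (on_pages (fun k => (rho k).1))) => //.
- by apply: on_pagesK => k; case: (rhoP k).
- by apply: on_pagesK => k; case: (rhoP k).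
rewrite subr0 -/t0 => t tr; apply: label_matching.
- by move=> k; case: (rhoP k) => K _ _ _; exact: K.
- by move=> k; case: (rhoP k) => _ K _ _; exact: K.
- by move=> k i; case: (rhoP k) => _ _ ->.
move=> k m tm; case: (rhoP k) => _ _ _ ->; rewrite ?addr0//.
have := ler_distD t (t0 - offset k) (m%:~R : R).
have := ler_distD t t0 (m%:~R + offset k).
rewrite (_ : t0 - offset k - m%:~R = t0 - (m%:~R + offset k)); last by ring.
by move=> h _; rewrite (le_lt_trans h)// ler_ltD.
Qed.

(** At most one page of each class is blank, so there are no two blank pages to swap. *)
Definition saturated x := forall k i i', (i <= k)%N -> (i' <= k)%N ->
  (forall n, x k n != i) -> (forall n, x k n != i') -> i = i'.

Lemma isom_translation x (g : isom (label_book (R := R) x)) : bounded_label x ->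
  exists n : int, forall z, pos (g z) = pos z + n%:~R.
Proof.
move=> xk.
have [n [rho [gpos _ _ _ _]]] := label_isometry xk xk (isom_bij g) (isom_mdist g).
by exists n.
Qed.

Lemma saturated_isom1 x (g : isom (label_book (R := R) x)) z : bounded_label x ->
  saturated x -> pos (g z) = pos z -> g = 1%g.
Proof.
move=> xk xsat gz; have [n [rho [gpos gheight gpage rhoP rhoE]]] :=
  label_isometry xk xk (isom_bij g) (isom_mdist g).
have n0 : n = 0.
  apply/eqP; rewrite -(intr_eq0 R); apply/eqP.
  by have := gpos z; rewrite gz => /esym/eqP; rewrite -subr_eq0 addrAC subrr add0r => /eqP.
have rho_id k i : (i <= k)%N -> rho k i = i.
  move=> ik; have [[m <-]|noi] := pselect (exists m, x k m = i).
    by rewrite -rhoE n0 addr0.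
  have [inj rho_le] := rhoP k.
  apply: (xsat k) => //; [exact: rho_le| |].
    move=> m; apply/eqP => mi; apply: noi; exists m.
    apply: inj; rewrite ?inE ?xk//.
    by rewrite -rhoE n0 addr0.
  by move=> m; apply/eqP => mi; apply: noi; exists m.
apply: isom_eq => w /=; apply: book_ext.
- by rewrite gpos n0 addr0.
- have := height_ge0 w; rewrite le_eqVlt => /orP[/eqP/esym w0|w0].
    by rewrite !height0_page// gheight.
  by rewrite gpage// rho_id ?label_page_le//; case: (page w).
- exact: gheight.
Qed.

Lemma label_isom_exists x (n : int) rho rho' :
  (forall k, cancel (rho k) (rho' k)) -> (forall k, cancel (rho' k) (rho k)) ->
  (forall k i, (rho k i <= k)%N = (i <= k)%N) ->
  (forall k m, x k (m + n) = rho k (x k m)) ->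
  exists g : isom (label_book (R := R) x),
    (forall z, pos (g z) = pos z + n%:~R) /\
    (forall z, 0 < height z -> page (g z) = on_pages rho (page z)).
Proof.
move=> K K' rho_le xE.
have m t : matching (label_profile (R := R) x) (label_profile x) n%:~R (on_pages rho) t.
  by apply: label_matching => //; exact: K.
have bij := transport_isom (on_pagesK K) (on_pagesK K') m.
have iso := fun z w => mdist_transport (can_inj (on_pagesK K)) (m (pos z)) (m (pos w)).
exists (Isom (iso : forall z w : label_book x, _) bij); split => [z|z z0] //=.
by rewrite page_transport.
Qed.

(** * Translations of labels without defect *)

Section undefected.
Variables (D : nat) (p : nat -> nat).
Hypothesis pp : periods p.
Let x := periodic_label false D p.

Lemma isom_shift (n : int) : exists g : isom (label_book (R := R) x),
  forall z, pos (g z) = pos z + n%:~R.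
Proof.
(* A cyclic rotation of the [p k] labelled pages that fixes the blank ones. *)
pose rho (a : int) k i := if (i < p k)%N then residue (p k) (i%:Z + a) else i.
have K a k : cancel (rho a k) (rho (- a) k).
  have /andP[p0 _] := pp k.
  move=> i; rewrite /rho; case: (ltnP i (p k)) => ip; last by rewrite ltnNge ip.
  by rewrite residue_lt// residue_modD// addrK residue_id.
have [||||g [gpos _]] := @label_isom_exists x n (rho n) (rho (- n)).
- exact: K.
- by move=> k; have := K (- n) k; rewrite opprK.
- move=> k i; have /andP[p0 pk] := pp k.
  rewrite /rho; case: (ltnP i (p k)) => // ip.
  have -> : (i <= k)%N by exact: leq_trans ip pk.
  by exact: leq_trans (residue_lt _ p0) pk.
- move=> k m; have /andP[p0 _] := pp k.
  by rewrite /x /periodic_label /= /rho residue_lt// residue_modD.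
- by exists g.
Qed.

Lemma undefected_cocompact : isom_cocompact_unit_ball (label_book (R := R) x).
Proof.
pose o : label_book (R := R) x := spine (label_profile x) 0.
have cover : isom_translates (cball o 1) = [set: label_book (R := R) x].
  apply/seteqP; split => // z _.
  have [g gpos] := isom_shift (Num.floor (pos z)).
  have [h gK hK] := isom_bij g.
  exists g => //; exists (h z); last exact: hK.
  have := gpos (h z); rewrite hK => hz.
  have := Num.Theory.floor_itv (pos z); rewrite intrD => /andP[z0 z1].
  rewrite /cball /=; apply/mdist_leP; split.
    by rewrite pos_point sub0r normrN ger0_norm; lra.
  rewrite /page_dist height_spine star_dist0 ?height_ge0//.
  by have := le_trans (height_le (h z)) (sheet_le_half _ _ _); lra.
by split; [exists (cball o 1) => //; exact: book_proper|exists o].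
Qed.

(** The shift of an isometry is additive, has trivial kernel by saturation, and takes every integer
    value by [isom_shift]. *)
Lemma undefected_isom_Z : saturated x -> isom_Z_free (label_book (R := R) x).
Proof.
move=> xsat; have xk : bounded_label x by move=> k n; exact: periodic_label_le.
split; last by move=> z g gz; apply: (saturated_isom1 xk xsat (z := z)); rewrite gz.
have /choice[phi phiP] : forall g : isom (label_book (R := R) x), exists n : int,
    forall z, pos (g z) = pos z + n%:~R by move=> g; exact: isom_translation.
have phiE (g : isom (label_book (R := R) x)) n (z : label_book x) : pos (g z) = pos z + n%:~R -> phi g = n.
  by rewrite phiP => /addrI/eqP; rewrite eqr_int => /eqP.
pose o : label_book (R := R) x := spine (label_profile x) 0.
have phiM (g h : isom (label_book (R := R) x)) : phi (g * h)%g = phi g + phi h.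
  by apply: (phiE _ _ o); rewrite /= !phiP intrD -addrA [_%:~R + _]addrC.
have phi1 : phi 1%g = 0 by apply: (phiE _ _ o); rewrite addr0.
have phi0 (g : isom (label_book (R := R) x)) : phi g = 0 -> g = 1%g.
  by move=> g0; apply: (saturated_isom1 xk xsat (z := o)); rewrite phiP g0 addr0.
exists phi => //.
have /choice[psi psiP] := isom_shift.
exists psi; last by move=> n; apply: (phiE _ _ o).
move=> g; set h := psi _.
have hg : phi h = phi g by apply: (phiE _ _ o); exact: psiP.
have /phi0 hg1 : phi (h^-1 * g)%g = 0 by rewrite phiM -hg -phiM mulVg phi1.
by rewrite -[RHS](mulVKg h) hg1 mulg1.
Qed.

End undefected.

End assembly.

(** * Defects and swaps *)

Section defects.
Context {R : realType}.
Implicit Types (D : nat) (p q : nat -> nat).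

Lemma periodic_label_ne b D p k n : k != D -> periodic_label b D p k n = residue (p k) n.
Proof. by rewrite /periodic_label => /negbTE ->; rewrite andbF. Qed.

(** An isometry shifts labels and renames them injectively, so the returns to a label, and hence the
    period, are invariant in every class away from the defect. *)
Lemma isometric_period b c D p q k : periods p -> periods q -> k != D ->
  isometric (label_book (R := R) (periodic_label b D p))
    (label_book (periodic_label c D q)) -> p k = q k.
Proof.
move=> pp qq kD [g gbij gd].
have [n [rho [_ _ _ rhoP rhoE]]] := label_isometry
  (periodic_label_le b D pp) (periodic_label_le c D qq) gbij gd.
have {}rhoE m : residue (q k) (m + n) = rho k (residue (p k) m).
  by have := rhoE k m; rewrite !periodic_label_ne.
have /andP[p0 pk] := pp k; have /andP[q0 _] := qq k; have [inj _] := rhoP k.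
have pE m : residue (p k) m == residue (p k) 0 -> residue (q k) (m + n) == residue (q k) (0 + n).
  by move=> /eqP h; rewrite !rhoE h.
have qE m : residue (q k) (m + n) == residue (q k) (0 + n) -> residue (p k) m == residue (p k) 0.
  rewrite !rhoE => /eqP h; apply/eqP; apply: inj h;
    by rewrite inE -ltnS (leq_trans (residue_lt _ _)).
apply/eqP; rewrite eqn_dvd; apply/andP; split.
  have := qE (q k)%:Z; rewrite !residue_eq// subr0 => h.
  by move: h; rewrite add0r addrK dvdzz => /(_ isT).
have := pE (p k)%:Z; rewrite !residue_eq// subr0 => h.
by move: h; rewrite add0r addrK dvdzz => /(_ isT).
Qed.

(** In class [D] the label at 0 occurs nowhere else, while every other position shares its label
    with further ones; a nonzero shift would move 0 to such a position. *)
Lemma defect_fixes_pos D p (g : isom (label_book (R := R) (periodic_label true D p))) z :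
  periods p -> p D = D -> pos (g z) = pos z.
Proof.
move=> pp pD; have xk := periodic_label_le true D pp.
have [n [rho [gpos _ _ rhoP rhoE]]] := label_isometry xk xk (isom_bij g) (isom_mdist g).
have /andP[p0 _] := pp D; rewrite pD in p0.
suff n0 : n = 0 by rewrite gpos n0 addr0.
apply/eqP; apply: contraT => n0; have [inj _] := rhoP D.
have xE m : m != 0 -> periodic_label true D p D m = residue D m.
  by rewrite /periodic_label eqxx pD => /negbTE ->.
(* The multiple [d] of the period is chosen so that [n + d * D] avoids the defect: 1 works unless
   [n = - D], and then 2 does. *)
have [d [d0 nd]] : exists d : int, d != 0 /\ n + d * D%:Z != 0.
  have [nD|nD] := eqVneq (n + D%:Z) 0; last by exists 1; rewrite mul1r.
  by exists 2; split => //; apply/eqP; lia.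
have dD0 : d * D%:Z != 0 by rewrite mulf_neq0//; lia.
have : periodic_label true D p D 0 = periodic_label true D p D (d * D%:Z).
  apply: inj; rewrite ?inE ?xk//; rewrite -!rhoE add0r [_ * _ + n]addrC !xE//.
  by apply/eqP; rewrite residue_eq//; apply/dvdzP; exists (- d); ring.
rewrite (xE (d * D%:Z))// {1}/periodic_label !eqxx /= => DE.
by have := residue_lt (d * D%:Z) p0; rewrite -DE ltnn.
Qed.

(** All labels below [p k] occur, so only page [k] can be blank. *)
Lemma periodic_saturated b D p : periods p -> (forall k, (k <= p k)%N) ->
  saturated (periodic_label b D p).
Proof.
move=> pp kp k i i' ik i'k noi noi'; have /andP[p0 _] := pp k.
have top j : (j <= k)%N -> (forall n, periodic_label b D p k n != j) -> j = k.
  move=> jk noj; apply/eqP; rewrite eqn_leq jk leqNgt; apply/negP => jk'.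
  (* One period is added to stay clear of position 0, where a defect may replace the label. *)
  have := noj (j + p k)%N%:Z; rewrite /periodic_label.
  have -> : ((j + p k)%N%:Z == 0) = false by apply/negbTE; lia.
  rewrite !andbF => /eqP; apply.
  rewrite -[RHS](@residue_id (p k)); last exact: leq_trans jk' (kp k).
  by apply/eqP; rewrite residue_eq// PoszD addrAC subrr add0r dvdzz.
by rewrite (top i)// (top i').
Qed.

(** Isometries fix positions, and these are bounded on a compact set, so its translates miss far
    spine points. *)
Lemma defect_not_cocompact D p : periods p -> p D = D ->
  ~ cocompact_isom_group (label_book (R := R) (periodic_label true D p)).
Proof.
move=> pp pD [K cK KT]; set x := periodic_label true D p in K cK KT *.
have pos_cont : continuous (@pos R (label_profile x) : label_book x -> R).
  move=> z; apply: (iffRL (@pseudometric_normed_Zmodule.cvgrPdist_lt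
    _ _ _ (nbhs (z : label_book (R := R) x)) _ _ _)) => e e0.
  apply/(@nbhs_mdistP R (label_book x)); exists e => // w /= zw.
  exact: le_lt_trans (pos_mdist z w) zw.
have : compact (@pos R (label_profile x) @` K).
  by apply: continuous_compact => //; exact: continuous_subspaceT.
move=> /compact_bounded/pinfty_ex_gt0[M M0 KM].
have : isom_translates K (spine (label_profile x) (M + 1)) by rewrite KT.
move=> [g _ [w Kw gw]].
have := defect_fixes_pos g w pp pD; rewrite gw pos_point => wM.
have := KM (pos w) (ex_intro2 _ _ w Kw erefl).
by rewrite /= -wM ger0_norm; lra.
Qed.

(** In every class beyond [D] the pages [k.-1] and [k] are blank. They can be swapped independently
    according to [S], and Cantor's diagonal argument applies. *)
Lemma swap_isom_uncountable b D p : periods p -> (forall k, (D < k)%N -> (p k < k)%N) ->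
  uncountable_isom_group (label_book (R := R) (periodic_label b D p)).
Proof.
move=> pp pk; set x := periodic_label b D p.
have xk := periodic_label_le b D pp.
pose rho (S : nat -> bool) k := if (D < k)%N && S k then swap k.-1 k else id.
have rhoK S k : involutive (rho S k).
  by rewrite /rho; case: ifP => // _; exact: swapK.
have rho_le S k i : (rho S k i <= k)%N = (i <= k)%N.
  by rewrite /rho; case: ifP => // _; rewrite swap_le// leq_pred.
have rhoE S k m : x k (m + 0) = rho S k (x k m).
  rewrite addr0 /rho; case: ifP => // /andP[Dk _].
  rewrite /x periodic_label_ne ?gtn_eqF//; have /andP[p0 _] := pp k.
  have := residue_lt m p0; have := pk k Dk; rewrite /swap => h1 h2.
  by rewrite !ltn_eqF//; lia.
have /choice[G GP] : forall S, exists g : isom (label_book (R := R) x),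
    forall z, 0 < height z -> page (g z) = on_pages (rho S) (page z).
  move=> S; have [g [_ gP]] :=
    @label_isom_exists R _ _ _ _ (rhoK S) (rhoK S) (rho_le S) (rhoE S).
  by exists g.
have Ginj S T k : G S = G T -> (D < k)%N -> S k = T k.
  move=> ST Dk; pose z : label_book (R := R) x :=
    book_point (label_profile x) 0 (k, k) (amplitude k).
  have a0 := @amplitude_gt0 R k.
  have ak : amplitude k <= label_profile (R := R) x (k, k) 0.
    exact: (label_sheet_ge x 0 (leqnn k)).
  have zh : 0 < height z by rewrite height_point ?ak ?ltW.
  have zp : page z = (k, k) by rewrite page_point// a0 ak.
  have := GP S z zh; rewrite ST GP// zp /on_pages /= => -[].
  have kk : (k == k.-1) = false by lia.
  by rewrite /rho Dk /=; case: (S k); case: (T k); rewrite /swap ?eqxx ?kk ?eqxx//= => /eqP;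
    rewrite ?kk 1?eq_sym ?kk.
move=> /countable_injP[F Finj].
(* The diagonal sequence. Codes are moved beyond [D] because [G S] determines [S] only there. *)
pose S0 k := `[< exists S, (D + (F (G S)).+1)%N = k /\ ~~ S k >].
pose k0 := (D + (F (G S0)).+1)%N.
have Dk0 : (D < k0)%N by rewrite /k0; lia.
have : S0 k0 = ~~ S0 k0.
  apply/asboolP/idP => [[S [Sk nS]]|nS]; last by exists S0.
  suff <- : S k0 = S0 k0 by [].
  apply: Ginj => //; apply: Finj; rewrite ?inE//.
  by move: Sk; rewrite /k0; lia.
by case: (S0 k0).
Qed.

End defects.

(** * Families indexed by the reals *)

Section families.
Context {R : realType}.
Implicit Types (L e k : nat) (s t : R).

(** The Dedekind cut of [s] as a binary sequence along the coding of the rationals; indices that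
    code no rational give [false]. *)
Definition cut s (i : nat) : bool :=
  if unpickle i is Some q then ratr (q : rat) < s else false.

Lemma cut_inj s t : s != t -> exists i, cut s i != cut t i.
Proof.
wlog st : s t / s < t => [wl|_].
  rewrite neq_lt => /orP[st|ts]; first by apply: wl; rewrite ?lt_eqF.
  by have [|i] := wl t s ts; [rewrite lt_eqF|exists i; rewrite eq_sym].
have [q] := rat_in_itvoo st; rewrite in_itv /= => /andP[sq qt].
by exists (pickle q); rewrite /cut pickleK qt ltNge (ltW sq).
Qed.

(* Class [L.+1] is kept for the defect, the later ones have [e] or [e + 1]
   blank pages according to the binary digits of [s]. *)
Definition coded_period L e s k : nat :=
  if (k <= L)%N then k.+1 else if k == L.+1 then k
  else (k.+1 - (e + cut s (k - L.+2)))%N.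

Lemma coded_periods L e s : (0 < L)%N -> (e <= 2)%N -> periods (coded_period L e s).
Proof.
move=> L0 e2 k; rewrite /coded_period; case: (leqP k L) => kL; first by rewrite leqnn.
by case: (eqVneq k L.+1) => kL1; first lia; case: (cut _ _); lia.
Qed.

Lemma coded_period_D L e s : coded_period L e s L.+1 = L.+1.
Proof. by rewrite /coded_period ltnn eqxx. Qed.

Lemma coded_period_inj L e s t : (e <= 2)%N -> s != t ->
  exists2 k, k != L.+1 & coded_period L e s k != coded_period L e t k.
Proof.
move=> e2 /cut_inj[i st]; exists (L.+2 + i)%N; first by lia.
rewrite /coded_period; have -> : (L.+2 + i <= L)%N = false by lia.
have -> : (L.+2 + i == L.+1)%N = false by lia.
rewrite addKn; move: st; case: (cut s i); case: (cut t i) => //= _; lia.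
Qed.

Lemma coded_not_isometric b L e s t : (0 < L)%N -> (e <= 2)%N -> s != t ->
  ~ isometric (label_book (R := R) (periodic_label b L.+1 (coded_period L e s)))
      (label_book (periodic_label b L.+1 (coded_period L e t))).
Proof.
move=> L0 e2 /(coded_period_inj L e2)[k kD /eqP st] iso; apply: st.
by apply: isometric_period kD iso; exact: coded_periods.
Qed.

Lemma coded_locally_modelled (r : R) b L e s : 0 < r -> 2 * r + 2 <= L%:R ->
  (0 < L)%N -> (e <= 2)%N ->
  locally_modelled r (label_book (R := R) model)
    (label_book (periodic_label b L.+1 (coded_period L e s))).
Proof.
move=> r0 rL L0 e2; have pp := coded_periods s L0 e2.
apply: (label_locally_modelled (ltW r0) rL); first exact: periodic_label_le.
apply: periodic_label_spread => //; first exact: coded_period_D.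
move=> k; rewrite /coded_period; case: (leqP k L) => kL; first by left.
(* From [L.+2] on at most three pages are blank, so the period is at least [k - 2] and hence at
   least [L]. *)
by right; case: (eqVneq k L.+1) => kL1; first lia; case: (cut _ _); lia.
Qed.

(** With [e = 0] the periods are [k] or [k.+1], leaving at most one blank page. *)
Lemma coded_saturated b L s : (0 < L)%N ->
  saturated (periodic_label b L.+1 (coded_period L 0 s)).
Proof.
move=> L0; apply: periodic_saturated; first exact: coded_periods.
move=> k; rewrite /coded_period; case: (leqP k L) => kL; first by [].
by case: (eqVneq k L.+1) => kL1 //; case: (cut _ _); lia.
Qed.

(** With [e = 2] every class beyond [L.+1] has two or three blank pages. *)
Lemma coded_uncountable b L s : (0 < L)%N ->
  uncountable_isom_group (label_book (R := R)
    (periodic_label b L.+1 (coded_period L 2 s))).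
Proof.
move=> L0; apply: swap_isom_uncountable; first exact: coded_periods.
move=> k Lk; rewrite /coded_period [(k <= L)%N]leqNgt (ltnW Lk) /= gtn_eqF//.
by case: (cut _ _); lia.
Qed.

End families.

Theorem theorem12 (R : realType) :
  exists X : metricType R,
    proper_geodesic_contractible X /\
    isom_Z_free X /\
    isom_cocompact_unit_ball X /\
    (forall r : R, 0 < r ->
      continuum_of_nonisometric (fun Y : metricType R =>
        [/\ locally_modelled r X Y, proper_geodesic_contractible Y,
            isom_Z_free Y & isom_cocompact_unit_ball Y])) /\
    (forall r : R, 0 < r ->
      continuum_of_nonisometric (fun Y : metricType R =>
        locally_modelled r X Y /\ trivial_isom_group Y)) /\
    (forall r : R, 0 < r ->
      continuum_of_nonisometric (fun Y : metricType R =>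
        [/\ locally_modelled r X Y, uncountable_isom_group Y &
            cocompact_isom_group Y]) /\
      continuum_of_nonisometric (fun Y : metricType R =>
        [/\ locally_modelled r X Y, uncountable_isom_group Y &
            ~ cocompact_isom_group Y])).
Proof.
have large (r : R) : exists2 L : nat, (0 < L)%N & 2 * r + 2 <= L%:R.
  by exists (Num.truncn (2 * r + 2)).+1 => //; exact/ltW/truncnS_gt.
have succ_periods : periods succn by move=> k; rewrite leqnn.
(* By computation this label, with period [k.+1] in class [k] and no defect, is [model]. *)
have model_saturated : saturated (periodic_label false 0 succn).
  by apply: periodic_saturated.
exists (label_book (R := R) model); split; first exact: label_book_good.
split; first exact: (undefected_isom_Z succ_periods model_saturated).
split; first exact: (undefected_cocompact 0 succ_periods).
split=> [r r0|]; last split=> [r r0|r r0]; have [L L0 rL] := large r.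
(* No defect and no pair of blank pages: exactly the translations survive. *)
- exists (fun s => label_book (periodic_label false L.+1 (coded_period L 0 s))).
  split=> [s|s t]; last exact: coded_not_isometric.
  have pp := coded_periods (e := 0) s L0 isT.
  split; [exact: coded_locally_modelled|exact: label_book_good| |].
    exact: (undefected_isom_Z pp (coded_saturated L0)).
  exact: undefected_cocompact.
(* The defect removes the translations, and there are still no swaps. *)
- exists (fun s => label_book (periodic_label true L.+1 (coded_period L 0 s))).
  split=> [s|s t]; last exact: coded_not_isometric.
  have pp := coded_periods (e := 0) s L0 isT.
  split; first exact: coded_locally_modelled.
  move=> g; apply: (saturated_isom1 (z := spine (label_profile _) 0)).
  + exact: periodic_label_le.
  + exact: coded_saturated.
  + by apply: defect_fixes_pos => //; exact: coded_period_D.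
split.
(* Swaps of blank pages together with all translations. *)
- exists (fun s => label_book (periodic_label false L.+1 (coded_period L 2 s))).
  split=> [s|s t]; last exact: coded_not_isometric.
  have pp := coded_periods (e := 2) s L0 isT.
  split; [exact: coded_locally_modelled|exact: coded_uncountable|].
  by case: (undefected_cocompact (R := R) L.+1 pp).
(* Swaps of blank pages, but no translations because of the defect. *)
- exists (fun s => label_book (periodic_label true L.+1 (coded_period L 2 s))).
  split=> [s|s t]; last exact: coded_not_isometric.
  have pp := coded_periods (e := 2) s L0 isT.
  split; [exact: coded_locally_modelled|exact: coded_uncountable|].
  exact: defect_not_cocompact pp (coded_period_D _ _ _).
Qed.
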